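(* Let $(P,Q)$ be a quasi-projection pair on a Hilbert $C^*$-module $\mathscr{H}$. Let $T_1=P(I-Q)$, $T_2=(I-P)Q$, $\widetilde{T_1}=T_1(2P-I)$, $\widetilde{T_2}=-T_2(2P-I)$, $\mathscr{H}_1=\mathcal{R}(P)\cap\mathcal{R}(Q)$ and $\mathscr{H}_4=\mathcal{N}(P)\cap\mathcal{N}(Q)$. Then the following statements are equivalent: (i) $(P,Q)$ is semi-harmonious; (ii) $\overline{\mathcal{R}(T_1)}$ and $\overline{\mathcal{R}(T_2)}$ are both orthogonally complemented in $\mathscr{H}$; (iii) $\overline{\mathcal{R}(T_1^* )}$ and $\overline{\mathcal{R}(T_2^* )}$ are both orthogonally complemented in $\mathscr{H}$; (iv) $\overline{\mathcal{R}(\widetilde{T_1})}$ and $\overline{\mathcal{R}(\widetilde{T_2})}$ are both orthogonally complemented in $\mathscr{H}$; (v) $\overline{\mathcal{R}(\widetilde{T_1}^* )}$ and $\overline{\mathcal{R}(\widetilde{T_2}^* )}$ are both orthogonally complemented in $\mathscr{H}$; (vi) $\overline{\mathcal{R}(T_1)}$ and $\overline{\mathcal{R}(T_1^* )}$ are both orthogonally complemented in $\mathscr{H}$; (vii) $T_1$ has the polar decomposition; (viii) $\overline{\mathcal{R}(T_1^* )}$ and $\overline{\mathcal{R}(\widetilde{T_2}^* )}$ are both orthogonally complemented in $\mathscr{H}$; (ix) $\overline{\mathcal{R}(T_2)}$ and $\overline{\mathcal{R}(T_2^* )}$ are both orthogonally complemented in $\mathscr{H}$; (x) $T_2$ has the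 polar decomposition; (xi) $\overline{\mathcal{R}(T_2^* )}$ and $\overline{\mathcal{R}(\widetilde{T_1}^* )}$ are both orthogonally complemented in $\mathscr{H}$. In each case (that is, whenever these equivalent statements hold), $\mathscr{H}_1$ and $\mathscr{H}_4$ are orthogonally complemented in $\mathscr{H}$, and $$P=P_{\overline{\mathcal{R}(T_1)}}+P_{\mathscr{H}_1},\quad P_{\mathcal{R}(Q)}=P_{\overline{\mathcal{R}(\widetilde{T_2}^* )}}+P_{\mathscr{H}_1},$$ $$I-P=P_{\overline{\mathcal{R}(T_2)}}+P_{\mathscr{H}_4},\quad P_{\mathcal{N}(Q)}=P_{\overline{\mathcal{R}(\widetilde{T_1}^* )}}+P_{\mathscr{H}_4}.$$
   Context: $\mathfrak{A}$ is a $C^*$-algebra and $\mathscr{H}$ is a (right) Hilbert $\mathfrak{A}$-module; $\mathcal{L}(\mathscr{H})$ is the $C^*$-algebra of adjointable operators on $\mathscr{H}$, and $I$ is the identity operator on $\mathscr{H}$. For $T\in\mathcal{L}(\mathscr{H})$, $\mathcal{R}(T)$, $\mathcal{N}(T)$, $T^*$ denote its range, null space and adjoint, and $|T|=(T^*T)^{1/2}$; the bar denotes norm closure. An idempotent is $Q\in\mathcal{L}(\mathscr{H})$ with $Q^2=Q$; a projection is a self-adjoint idempotent. A closed submodule $\mathscr{M}$ of $\mathscr{H}$ is orthogonally complemented in $\mathscr{H}$ if $\mathscr{H}=\mathscr{M}+\mathscr{M}^\perp$, where $\mathscr{M}^\perp=\{x\in\mathscr{H}:\langle x,y\rangle=0\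 \forall y\in\mathscr{M}\}$; then $P_{\mathscr{M}}$ denotes the projection from $\mathscr{H}$ onto $\mathscr{M}$. $T\in\mathcal{L}(\mathscr{H})$ has the polar decomposition if there is a partial isometry $U\in\mathcal{L}(\mathscr{H})$ with $T=U|T|$ and $U^*U=P_{\overline{\mathcal{R}(T^* )}}$ (in particular $\overline{\mathcal{R}(T^* )}$ is orthogonally complemented). A quasi-projection pair $(P,Q)$ on $\mathscr{H}$ consists of a projection $P\in\mathcal{L}(\mathscr{H})$ and an idempotent $Q\in\mathcal{L}(\mathscr{H})$ such that $PQ^*P=PQP$, $PQ^*(I-P)=-PQ(I-P)$ and $(I-P)Q^*(I-P)=(I-P)Q(I-P)$; equivalently, $Q^*=(2P-I)Q(2P-I)$. A quasi-projection pair $(P,Q)$ is semi-harmonious if both $P(I-Q)$ and $(I-P)Q$ have the polar decomposition. *)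

(* Defs.v *)
From HB Require Import structures.
From mathcomp Require Import all_boot all_order all_algebra.
From mathcomp Require Import all_classical all_reals all_analysis.
From mathcomp Require Import complex.

Set Implicit Arguments.
Unset Strict Implicit.
Unset Printing Implicit Defensive.

Import Order.TTheory GRing.Theory Num.Theory.
Import numFieldNormedType.Exports.

Local Open Scope classical_set_scope.
Local Open Scope ring_scope.

(* MathComp rings are unital, whereas a C*-algebra need not be; the product is
   therefore put directly on the Banach space.  Norms take values in R[i]. *)
HB.mixin Record isCStarAlgebra (R : realType) A
    of CompleteNormedModule R[i] A := {
  cmul : A -> A -> A;
  cstar : A -> A;
  cmulA : forall a b c, cmul a (cmul b c) = cmul (cmul a b) c;
  cmulDl : forall a b c, cmul (a + b) c = cmul a c + cmul b c;
  cmulDr : forall a b c, cmul a (b + c) = cmul a b + cmul a c;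
  cmulZl : forall (k : R[i]) a b, cmul (k *: a) b = k *: cmul a b;
  cmulZr : forall (k : R[i]) a b, cmul a (k *: b) = k *: cmul a b;
  cnormM : forall a b, `|cmul a b| <= `|a| * `|b|;
  cstarK : forall a, cstar (cstar a) = a;
  cstarD : forall a b, cstar (a + b) = cstar a + cstar b;
  cstarZ : forall (k : R[i]) a, cstar (k *: a) = (k^*)%C *: cstar a;
  cstarM : forall a b, cstar (cmul a b) = cmul (cstar b) (cstar a);
  cnorm_star : forall a, `|cmul (cstar a) a| = `|a| ^+ 2
}.

#[short(type="cstarAlgType")]
HB.structure Definition CStarAlgebra (R : realType) :=
  {A of isCStarAlgebra R A & CompleteNormedModule R[i] A}.

Definition cpositive (R : realType) (A : cstarAlgType R) (a : A) : Prop :=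
  exists b : A, a = cmul (cstar b) b.

(* Right Hilbert A-module; the inner product is linear in its second variable.
   Completeness refers to the norm |<x, x>|^(1/2), see hip_norm. *)
HB.mixin Record isHilbertModule (R : realType) (A : cstarAlgType R) H
    of CompleteNormedModule R[i] H := {
  hact : H -> A -> H;
  hip : H -> H -> A;
  hactDl : forall x y a, hact (x + y) a = hact x a + hact y a;
  hactDr : forall x a b, hact x (a + b) = hact x a + hact x b;
  hactM : forall x a b, hact x (cmul a b) = hact (hact x a) b;
  hactZl : forall (k : R[i]) x a, hact (k *: x) a = k *: hact x a;
  hactZr : forall (k : R[i]) x a, hact x (k *: a) = k *: hact x a;
  hipDr : forall x y z, hip x (y + z) = hip x y + hip x z;
  hipZr : forall (k : R[i]) x y, hip x (k *: y) = k *: hip x y;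
  hip_act : forall x y a, hip x (hact y a) = cmul (hip x y) a;
  hip_star : forall x y, hip y x = cstar (hip x y);
  hip_ge0 : forall x, cpositive (hip x x);
  hip_eq0 : forall x, hip x x = 0 -> x = 0;
  hip_norm : forall x, `|x| ^+ 2 = `|hip x x|
}.

#[short(type="hilbertModType")]
HB.structure Definition HilbertModule (R : realType) (A : cstarAlgType R) :=
  {H of isHilbertModule R A H & CompleteNormedModule R[i] H}.

Section HilbertModuleTheory.
Variables (R : realType) (A : cstarAlgType R) (H : hilbertModType A).
Implicit Types x y z : H.

Lemma hipDl x y z : hip (x + y) z = hip x z + hip y z.
Proof.
by rewrite (hip_star z (x + y)) hipDr cstarD -!hip_star.
Qed.

Lemma hip0r x : hip x 0 = 0.
Proof. by apply: (addrI (hip x 0)); rewrite -hipDr !addr0. Qed.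

Lemma hip0l x : hip 0 x = 0.
Proof. by apply: (addrI (hip 0 x)); rewrite -hipDl !addr0. Qed.

Lemma hipNr x y : hip x (- y) = - hip x y.
Proof. by apply/eqP; rewrite -addr_eq0 -hipDr addNr hip0r. Qed.

Lemma hipNl x y : hip (- x) y = - hip x y.
Proof. by apply/eqP; rewrite -addr_eq0 -hipDl addNr hip0l. Qed.

Lemma hip_inj x y : (forall z, hip z x = hip z y) -> x = y.
Proof.
move=> xy; apply/eqP; rewrite -subr_eq0; apply/eqP/hip_eq0.
by rewrite hipDr hipNr xy subrr.
Qed.

End HilbertModuleTheory.

(* Adjointability forces A-linearity and boundedness. *)
Record adjop (R : realType) (A : cstarAlgType R) (H : hilbertModType A) := Adjop {
  adjop_fun :> H -> H;
  adjop_adj : H -> H;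
  adjopP : forall x y, hip (adjop_fun x) y = hip x (adjop_adj y)
}.

Section AdjointableOperators.
Variables (R : realType) (A : cstarAlgType R) (H : hilbertModType A).
Implicit Types (S T U : adjop H) (M : set H).

Lemma adjopPr T x y : hip (adjop_adj T x) y = hip x (T y).
Proof. by rewrite (hip_star y) -adjopP -hip_star. Qed.

Lemma adjop_ext S T : (forall x, S x = T x) -> S = T.
Proof.
case: S T => [s s' sP] [t t' tP] /= st.
have {}st : s = t by apply/funext.
subst t; have st' : s' = t'.
  by apply/funext => y; apply: hip_inj => z; rewrite -sP tP.
by subst t'; rewrite (Prop_irrelevance sP tP).
Qed.

Lemma adjopD T x y : T (x + y) = T x + T y.
Proof. by apply: hip_inj => z; rewrite hipDr -!adjopPr hipDr. Qed.

Definition adj T : adjop H := Adjop (adjopPr T).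

Fact adjop_zero_subproof x y : hip (0 : H) y = hip x (0 : H).
Proof. by rewrite hip0l hip0r. Qed.
Definition adjop_zero : adjop H := Adjop adjop_zero_subproof.

Fact adjop_opp_subproof T x y : hip (- T x) y = hip x (- adj T y).
Proof. by rewrite hipNl hipNr adjopP. Qed.
Definition adjop_opp T : adjop H := Adjop (adjop_opp_subproof T).

Fact adjop_add_subproof S T x y :
  hip (S x + T x) y = hip x (adj S y + adj T y).
Proof. by rewrite hipDl hipDr !adjopP. Qed.
Definition adjop_add S T : adjop H := Adjop (adjop_add_subproof S T).

Fact adjop_one_subproof x y : hip (id x : H) y = hip x (id y : H).
Proof. by []. Qed.
Definition adjop_one : adjop H := Adjop adjop_one_subproof.

Fact adjop_mul_subproof S T x y : hip (S (T x)) y = hip x (adj T (adj S y)).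
Proof. by rewrite !adjopP. Qed.
Definition adjop_mul S T : adjop H := Adjop (adjop_mul_subproof S T).

HB.instance Definition _ := gen_eqMixin (adjop H).
HB.instance Definition _ := gen_choiceMixin (adjop H).

Fact adjop_addA : associative adjop_add.
Proof. by move=> S T U; apply: adjop_ext => x /=; rewrite addrA. Qed.
Fact adjop_addC : commutative adjop_add.
Proof. by move=> S T; apply: adjop_ext => x /=; rewrite addrC. Qed.
Fact adjop_add0 : left_id adjop_zero adjop_add.
Proof. by move=> T; apply: adjop_ext => x /=; rewrite add0r. Qed.
Fact adjop_addN : left_inverse adjop_zero adjop_opp adjop_add.
Proof. by move=> T; apply: adjop_ext => x /=; rewrite addNr. Qed.

HB.instance Definition _ := GRing.isZmodule.Build (adjop H)
  adjop_addA adjop_addC adjop_add0 adjop_addN.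

Fact adjop_mulA : associative adjop_mul.
Proof. by move=> S T U; apply: adjop_ext. Qed.
Fact adjop_mul1l : left_id adjop_one adjop_mul.
Proof. by move=> T; apply: adjop_ext. Qed.
Fact adjop_mul1r : right_id adjop_one adjop_mul.
Proof. by move=> T; apply: adjop_ext. Qed.
Fact adjop_mulDl : left_distributive adjop_mul +%R.
Proof. by move=> S T U; apply: adjop_ext. Qed.
Fact adjop_mulDr : right_distributive adjop_mul +%R.
Proof. by move=> S T U; apply: adjop_ext => x /=; rewrite adjopD. Qed.

(* The ring L(H), with composition as product; possibly trivial. *)
HB.instance Definition _ := GRing.Zmodule_isPzRing.Build (adjop H)
  adjop_mulA adjop_mul1l adjop_mul1r adjop_mulDl adjop_mulDr.

Definition ran T : set H := range T.
Definition ker T : set H := [set x | T x = 0].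

Definition is_idempotent T : Prop := T * T = T.
Definition is_projection T : Prop := is_idempotent T /\ adj T = T.

Definition op_positive T : Prop := exists S, T = adj S * S.

(* |T|, the positive square root of T^* T in L(H); the default value 0 would be
   taken only if there were none. *)
Definition absop T : adjop H :=
  xget 0 [set B | op_positive B /\ B * B = adj T * T].

Definition closed_submodule M : Prop :=
  [/\ closed M, M 0, forall x y, M x -> M y -> M (x + y),
      forall (k : R[i]) x, M x -> M (k *: x) &
      forall x (a : A), M x -> M (hact x a)].

Definition orth M : set H := [set x | forall y, M y -> hip x y = 0].

Definition orth_complemented M : Prop :=
  closed_submodule M /\
  forall x, exists y z, [/\ M y, orth M z & x = y + z].

(* P_M; meaningful only if M is orthogonally complemented, and 0 otherwise. *)
Definition proj_on M : adjop H :=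
  xget 0 [set E | is_projection E /\ ran E = M].

Definition partial_isometry U : Prop := is_projection (adj U * U).

Definition has_polar_decomposition T : Prop :=
  orth_complemented (closure (ran (adj T))) /\
  exists U, [/\ partial_isometry U, T = U * absop T &
                adj U * U = proj_on (closure (ran (adj T)))].

Definition quasi_projection_pair (P Q : adjop H) : Prop :=
  [/\ is_projection P, is_idempotent Q,
      P * adj Q * P = P * Q * P,
      P * adj Q * (1 - P) = - (P * Q * (1 - P)) &
      (1 - P) * adj Q * (1 - P) = (1 - P) * Q * (1 - P)].

Definition semi_harmonious (P Q : adjop H) : Prop :=
  has_polar_decomposition (P * (1 - Q)) /\
  has_polar_decomposition ((1 - P) * Q).

End AdjointableOperators.

(* Main.v *)
From HB Require Import structures.
Require Import Defs.
From mathcomp Require Import all_boot all_order all_algebra.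
From mathcomp Require Import all_classical all_reals all_analysis.
From mathcomp Require Import complex ring lra.

Set Implicit Arguments.
Unset Strict Implicit.
Unset Printing Implicit Defensive.

Import Order.TTheory GRing.Theory Num.Theory.
Import numFieldNormedType.Exports.

Local Open Scope classical_set_scope.
Local Open Scope ring_scope.

(** Write J := 2 P - 1, a self-adjoint unitary.  The three block identities of a
    quasi-projection pair amount to Q^* = J Q J, whence
    (T1 J)^* = (1 - Q) P and (- T2 J)^* = Q (1 - P).
    As J is unitary, multiplying T1 or T2 by +-J on either side does not change
    whether the closure of a range is orthogonally complemented, so every
    condition but those on polar decompositions is about four submodules: the
    closures of the ranges of P (1 - Q), (1 - P) Q, Q (1 - P) and (1 - Q) P.

    The first is complemented iff R(P) is its sum with H1 := R(P) /\ R(Q), and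
    the third iff R(Q) is its sum with H1: in both cases H1 turns out to be the
    orthogonal complement inside the complemented submodule R(P) or R(Q).  Since
    Q P (1 - Q) = - Q (1 - P) (1 - Q), applying Q to the decomposition of R(P)
    gives that of R(Q), and P leads back (reflected_pair_half).  So the first
    and the third submodule are complemented together.  Replacing (P, Q) by
    (1 - P, 1 - Q) turns this into the same statement about the second and the
    fourth submodule and H4.  All conditions then say that all four submodules
    are complemented, and the formulas for the projections restate the
    decompositions.

    This rests on two facts about an adjointable operator T: T has the polar
    decomposition iff the closures of the ranges of T and of T^* are
    complemented (polarP), and the range of an idempotent is complemented
    (idem_ran_oc).  Both need |T| or the invertibility of T^* T + e, that is,
    positivity of T^* T in L(H).  The positive cone is described by norms: h is
    positive when it is self-adjoint and |c - h| <= c for some c > 0.  Such an h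
    has a square root, the limit of an explicit iteration (sqrt_op), and T^* T is
    positive by a variant of Kaplansky's argument inside L(H)
    (poscone_adjM).  Norm estimates only use that |<x, y>| <= 4 |x| |y|, which is
    polarization (hip_bound), and that adjointable operators are bounded, proved
    by a gliding hump (adjop_bounded). *)

(** * Real-valued norms and sequences *)

Section RealNorm.
Variables (R : realType) (V : normedModType R[i]).
Implicit Types (x y z l : V) (u : nat -> V) (M : set V).
Local Open Scope complex_scope.

(** Norms in an R[i]-normed module are elements of R[i]; this is the same norm
    with values in R, where the order is total. *)
Definition nrm x : R := complex.Re `|x|.

Lemma normE x : `|x| = (nrm x)%:C.
Proof. by rewrite /nrm RRe_real // ger0_real. Qed.

Lemma nrm_ge0 x : 0 <= nrm x.
Proof. by rewrite -ler0c -normE. Qed.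

Lemma nrm0 : nrm 0 = 0.
Proof. by rewrite /nrm normr0. Qed.

Lemma nrm_eq0 x : nrm x = 0 -> x = 0.
Proof. by move=> h; apply/eqP; rewrite -normr_eq0 normE h. Qed.

Lemma nrmN x : nrm (- x) = nrm x.
Proof. by rewrite /nrm normrN. Qed.

Lemma nrmC x y : nrm (x - y) = nrm (y - x).
Proof. by rewrite -nrmN opprB. Qed.

Lemma nrmD x y : nrm (x + y) <= nrm x + nrm y.
Proof. by rewrite -lecR rmorphD /= -!normE ler_normD. Qed.

Lemma nrmB x y : nrm (x - y) <= nrm x + nrm y.
Proof. by rewrite -(nrmN y) nrmD. Qed.

Lemma nrm_dist z x y : nrm (x - y) <= nrm (x - z) + nrm (z - y).
Proof. by rewrite -[x - y](subrKA z) nrmD. Qed.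

Lemma nrmZ (k : R[i]) x : nrm (k *: x) = complex.Re `|k| * nrm x.
Proof.
apply: complexI; rewrite -normE normrZ (normE x) rmorphM; congr (_ * _).
Qed.

Lemma nrmZr (k : R) x : 0 <= k -> nrm (k%:C *: x) = k * nrm x.
Proof.
by move=> k0; rewrite nrmZ ger0_norm ?ler0c.
Qed.

Lemma nrmZi x : nrm ('i%C *: x) = nrm x.
Proof. by rewrite nrmZ normc_def /= expr0n expr1n add0r sqrtr1 mul1r. Qed.

Lemma closure_nrmP M x :
  closure M x <-> forall e : R, 0 < e -> exists2 y, M y & nrm (x - y) < e.
Proof.
split=> [cl e e0 | h B /nbhs_normP [e /= e0 eB]].
  have /cl [y [My /=]] : nbhs x [set y | `|x - y| < e%:C].
    by apply/nbhs_normP; exists e%:C; rewrite //= ltcR.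
  by rewrite normE ltcR; exists y.
have er : e = (complex.Re e)%:C by rewrite RRe_real // gtr0_real.
have [|y My xy] := h (complex.Re e); first by rewrite -ltcR -er.
by exists y; split => //; apply: eB; rewrite /= normE er ltcR.
Qed.

Lemma cvg_nrmP u l :
  u n @[n --> \oo] --> l <->
  forall e : R, 0 < e -> exists N, forall n, (N <= n)%N -> nrm (l - u n) < e.
Proof.
split=> [/cvgrPdist_lt h e e0 | h].
  have [|N _ NP] := h e%:C; first by rewrite ltcR.
  by exists N => n Nn; rewrite -ltcR -normE; apply: NP.
apply/cvgrPdist_lt => e e0.
have er : e = (complex.Re e)%:C by rewrite RRe_real // gtr0_real.
have [|N NP] := h (complex.Re e); first by rewrite -ltcR -er.
by exists N => // n /= Nn; rewrite er normE ltcR NP.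
Qed.

Lemma cvg_nrm_le u l (y : V) (c : R) :
  u n @[n --> \oo] --> l ->
  (exists N, forall n, (N <= n)%N -> nrm (u n - y) <= c) -> nrm (l - y) <= c.
Proof.
move=> /cvg_nrmP ul [N NP]; apply/ler_addgt0Pl => e e0.
have [N' /(_ (maxn N N')) h] := ul e e0.
apply: le_trans (nrm_dist (u (maxn N N')) _ _) _.
by rewrite lerD ?NP ?leq_maxl // ltW // h ?leq_maxr.
Qed.

End RealNorm.

Lemma cauchy_nrm_cvg (R : realType) (V : completeNormedModType R[i])
    (u : nat -> V) :
  (forall e : R, 0 < e -> exists N, forall n, (N <= n)%N -> nrm (u n - u N) < e) ->
  exists l : V, u n @[n --> \oo] --> l.
Proof.
move=> h; suff cu : cvgn u by exists (limn u).
apply/cauchy_cvgP/cauchy_exP => e e0.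
have er : e = (complex.Re e)%:C%C by rewrite RRe_real // gtr0_real.
have [|N NP] := h (complex.Re e); first by rewrite -ltcR -er.
exists (u N), N => // n /= Nn.
by rewrite /= -ball_normE /= normE er ltcR nrmC NP.
Qed.

(** Only additivity is assumed because the inner product is conjugate-linear in
    its first variable. *)
Lemma additive_bounded_cvg (R : realType) (V W : normedModType R[i])
    (f : V -> W) (c : R) :
  (forall x y, f (x + y) = f x + f y) -> (forall x, nrm (f x) <= c * nrm x) ->
  forall (u : nat -> V) l,
    u n @[n --> \oo] --> l -> f (u n) @[n --> \oo] --> f l.
Proof.
move=> fD fb u l /cvg_nrmP ul; apply/cvg_nrmP => e e0.
have f0 : f 0 = 0 by apply: (addrI (f 0)); rewrite -fD !addr0.
have fN x : f (- x) = - f x by apply/eqP; rewrite -addr_eq0 -fD addNr f0.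
have d0 : 0 < `|c| + 1 by rewrite ltr_wpDl.
have [|N NP] := ul (e / (`|c| + 1)); first by rewrite divr_gt0.
exists N => n /NP; rewrite ltr_pdivlMr // -fN -fD => h.
apply: le_lt_trans (fb _) _; apply: le_lt_trans h.
rewrite mulrC ler_wpM2l ?nrm_ge0 //.
by rewrite (le_trans (ler_norm c)) // lerDl.
Qed.

(** * The inner product *)

Section InnerProduct.
Variables (R : realType) (A : cstarAlgType R) (H : hilbertModType A).
Implicit Types (x y z : H) (M : set H).
Local Open Scope complex_scope.

Lemma nrm_sqr x : nrm x ^+ 2 = nrm (hip x x).
Proof. by apply: complexI; rewrite rmorphXn /= -!normE hip_norm. Qed.

Lemma hipZl (k : R[i]) x y : hip (k *: x) y = k^* *: hip x y.
Proof. by rewrite hip_star hipZr cstarZ -hip_star. Qed.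

Lemma hipZlr (r : R) x y : hip (r%:C *: x) y = r%:C *: hip x y.
Proof. by rewrite hipZl; congr (_ *: _); apply: conjc_real. Qed.

Lemma hip_dist x v :
  hip (x + v) (x + v) - hip (x - v) (x - v) = 2%:R *: (hip x v + hip v x).
Proof.
have -> : hip (x + v) (x + v) = hip x x + hip v v + (hip x v + hip v x).
  by rewrite hipDl !hipDr [hip v x + _]addrC addrACA.
have -> : hip (x - v) (x - v) = hip x x + hip v v - (hip x v + hip v x).
  by rewrite hipDl !(hipDr, hipNl, hipNr) opprB addrACA opprD.
by rewrite opprB addrC addrA subrK -mulr2n scaler_nat.
Qed.

Lemma hip_polarization x y :
  hip (x + y) (x + y) - hip (x - y) (x - y)
    - 'i%C *: (hip (x + 'i%C *: y) (x + 'i%C *: y)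
               - hip (x - 'i%C *: y) (x - 'i%C *: y))
  = 4%:R *: hip x y.
Proof.
rewrite !hip_dist hipZr hipZl scalerA mulrC -scalerA -scalerBr.
rewrite [X in _ - X]scalerDr !scalerA.
have -> : ('i * 'i = -1 :> R[i])%C by rewrite -expr2 sqr_i.
have -> : ('i * 'i^* = 1 :> R[i])%C.
  by apply/eqP; rewrite eq_complex /= !(mul0r, mulr0, oppr0, opprK, add0r,
    addr0, mulrN, mulr1) !eqxx.
rewrite scaleN1r scale1r opprD opprK addrACA subrr addr0 -mulr2n.
by rewrite -[hip x y *+ 2]scaler_nat scalerA -natrM.
Qed.

(** The triangle inequality bounds <v, w> by (|v| + |w|)^2 through polarization;
    rescaling to vectors of equal norm gives the constant 4.  The constant 1 of
    the Cauchy-Schwarz inequality would require the order of A. *)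
Lemma hip_bound x y : nrm (hip x y) <= 4%:R * (nrm x * nrm y).
Proof.
have weak (v w : H) : nrm (hip v w) <= (nrm v + nrm w) ^+ 2.
  have sq u (s : H) : nrm s = nrm w -> u = v + s ->
      nrm (hip u u) <= (nrm v + nrm w) ^+ 2.
    move=> sw ->; rewrite -nrm_sqr ler_pXn2r ?nnegrE ?addr_ge0 ?nrm_ge0 //.
    by rewrite -sw nrmD.
  have /(congr1 (@nrm _ _)) := hip_polarization v w.
  have -> : 4%:R *: hip v w = (4%:R : R)%:C%C *: hip v w by rewrite rmorph_nat.
  rewrite nrmZr // => e4.
  have h1 := sq (v + w) w erefl erefl.
  have h2 := sq (v - w) (- w) (nrmN w) erefl.
  have h3 := sq (v + 'i%C *: w) _ (nrmZi w) erefl.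
  have h4 := sq (v - 'i%C *: w) (- ('i%C *: w)) (etrans (nrmN _) (nrmZi w)) erefl.
  have := nrmB (hip (v + w) (v + w) - hip (v - w) (v - w)) ('i%C *:
     (hip (v + 'i%C *: w) (v + 'i%C *: w) - hip (v - 'i%C *: w) (v - 'i%C *: w))).
  rewrite e4 nrmZi => h5.
  have h6 := nrmB (hip (v + w) (v + w)) (hip (v - w) (v - w)).
  have h7 := nrmB (hip (v + 'i%C *: w) (v + 'i%C *: w))
                  (hip (v - 'i%C *: w) (v - 'i%C *: w)).
  by lra.
have [x0|x0] := eqVneq (nrm x) 0.
  by rewrite (nrm_eq0 x0) hip0l !nrm0 mul0r mulr0.
have [y0|y0] := eqVneq (nrm y) 0.
  by rewrite (nrm_eq0 y0) hip0r !nrm0 !mulr0.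
have p0 : 0 < nrm x * nrm y by rewrite mulr_gt0 // lt_def nrm_ge0 ?x0 ?y0.
have := weak ((nrm y)%:C%C *: x) ((nrm x)%:C%C *: y).
rewrite hipZlr hipZr scalerA -rmorphM /= !nrmZr ?mulr_ge0 ?nrm_ge0 //.
rewrite [nrm y * nrm x]mulrC; move: p0; set a := nrm x * nrm y => p0.
by rewrite (_ : (a + a) ^+ 2 = a * (4%:R * a)); [rewrite ler_pM2l | ring].
Qed.

Lemma hip_cvgl (u : nat -> H) l y :
  u n @[n --> \oo] --> l -> hip (u n) y @[n --> \oo] --> hip l y.
Proof.
apply: (@additive_bounded_cvg _ _ _ (fun x => hip x y) (4%:R * nrm y)).
  by move=> v w; rewrite hipDl.
by move=> x; rewrite -mulrA [nrm y * _]mulrC hip_bound.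
Qed.

Lemma hip_cvgr (u : nat -> H) l y :
  u n @[n --> \oo] --> l -> hip y (u n) @[n --> \oo] --> hip y l.
Proof.
apply: (@additive_bounded_cvg _ _ _ (hip y) (4%:R * nrm y)).
  by move=> v w; rewrite hipDr.
by move=> x; rewrite -mulrA hip_bound.
Qed.

Lemma nrm_hact x (a : A) : nrm (hact x a) <= 4%:R * nrm a * nrm x.
Proof.
have [h0|h0] := eqVneq (nrm (hact x a)) 0.
  by rewrite h0 !mulr_ge0 ?nrm_ge0.
have p0 : 0 < nrm (hact x a) by rewrite lt_def nrm_ge0 h0.
rewrite -(ler_pM2l p0) -expr2 nrm_sqr hip_act.
have M (b c : A) : nrm (cmul b c) <= nrm b * nrm c.
  by rewrite -lecR rmorphM /= -!normE cnormM.
apply: le_trans (M _ _) _.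
rewrite (_ : _ * (_ * _) = (4%:R * (nrm (hact x a) * nrm x)) * nrm a); last by ring.
by rewrite ler_wpM2r ?nrm_ge0 ?hip_bound.
Qed.

Lemma nrm_le_sqr (c : R) x : 0 <= c -> nrm (hip x x) <= c ^+ 2 -> nrm x <= c.
Proof.
by move=> c0; rewrite -nrm_sqr ler_pXn2r ?nnegrE ?nrm_ge0.
Qed.

End InnerProduct.
(** * Adjointable operators: algebra and boundedness *)

Section OperatorAlgebra.
Variables (R : realType) (A : cstarAlgType R) (H : hilbertModType A).
Implicit Types (x y z : H) (S T U : adjop H) (k : R[i]) (c d r : R).
Local Open Scope complex_scope.

Lemma adjop0 T : T 0 = 0.
Proof. by apply: (addrI (T 0)); rewrite -adjopD !addr0. Qed.

Lemma adjopN T x : T (- x) = - T x.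
Proof. by apply/eqP; rewrite -addr_eq0 -adjopD addNr adjop0. Qed.

Lemma adjopB T x y : T (x - y) = T x - T y.
Proof. by rewrite adjopD adjopN. Qed.

Lemma adjopZ T k x : T (k *: x) = k *: T x.
Proof. by apply: hip_inj => z; rewrite hipZr -!adjopPr hipZr. Qed.

Lemma adjop_act T x (a : A) : T (hact x a) = hact (T x) a.
Proof. by apply: hip_inj => z; rewrite hip_act -!adjopPr hip_act. Qed.

Fact adjop_scale_subproof k T x y :
  hip (k *: T x) y = hip x (k^* *: adj T y).
Proof. by rewrite hipZl hipZr adjopP. Qed.
Definition adjop_scale k T : adjop H := Adjop (adjop_scale_subproof k T).

Fact adjop_scaleA k l T :
  adjop_scale k (adjop_scale l T) = adjop_scale (k * l) T.
Proof. by apply: adjop_ext => x /=; rewrite scalerA. Qed.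
Fact adjop_scale1 : left_id 1 adjop_scale.
Proof. by move=> T; apply: adjop_ext => x /=; rewrite scale1r. Qed.
Fact adjop_scaleDr : right_distributive adjop_scale +%R.
Proof. by move=> k S T; apply: adjop_ext => x /=; rewrite scalerDr. Qed.
Fact adjop_scaleDl T : {morph adjop_scale^~ T : k l / k + l}.
Proof. by move=> k l; apply: adjop_ext => x /=; rewrite scalerDl. Qed.

HB.instance Definition _ := GRing.Zmodule_isLmodule.Build R[i] (adjop H)
  adjop_scaleA adjop_scale1 adjop_scaleDr adjop_scaleDl.

Lemma adjop_scaleAl k S T : k *: (S * T) = (k *: S) * T.
Proof. exact: adjop_ext. Qed.

Lemma adjop_scaleAr k S T : k *: (S * T) = S * (k *: T).
Proof. by apply: adjop_ext => x /=; rewrite adjopZ. Qed.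

Lemma adjE x y T : hip (T x) y = hip x (adj T y). Proof. exact: adjopP. Qed.
Lemma adjEr x y T : hip x (T y) = hip (adj T x) y.
Proof. by rewrite adjopPr. Qed.

Lemma adjK T : adj (adj T) = T. Proof. exact: adjop_ext. Qed.
Lemma adj0 : adj (0 : adjop H) = 0. Proof. exact: adjop_ext. Qed.
Lemma adj1 : adj (1 : adjop H) = 1. Proof. exact: adjop_ext. Qed.
Lemma adjD S T : adj (S + T) = adj S + adj T. Proof. exact: adjop_ext. Qed.
Lemma adjN T : adj (- T) = - adj T. Proof. exact: adjop_ext. Qed.
Lemma adjB S T : adj (S - T) = adj S - adj T. Proof. exact: adjop_ext. Qed.
Lemma adjM S T : adj (S * T) = adj T * adj S. Proof. exact: adjop_ext. Qed.
Lemma adjZ k T : adj (k *: T) = k^* *: adj T. Proof. exact: adjop_ext. Qed.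
Lemma adjZr c T : adj (c%:C *: T) = c%:C *: adj T.
Proof. by rewrite adjZ; congr (_ *: _); apply: conjc_real. Qed.
Lemma adjZi T : adj ('i%C *: T) = - ('i%C *: adj T).
Proof.
rewrite adjZ -scaleNr; congr (_ *: _); apply/eqP.
by rewrite eq_complex /= oppr0 !eqxx.
Qed.

Definition opbound T c := forall x, nrm (T x) <= c * nrm x.

(** Uniform boundedness for the functionals x |-> <T y, x> = <y, T^* x> with
    |y| <= 1, which are bounded at each x; the proof is a gliding hump.  The
    vectors y n have |T (y n)| > 18^n, and the n-th step has length 9^-n.  At
    u n.+1 the n-th functional is at least |T (y n)| / 9^n > 2^n.  The limit l is
    within 9^-n / 8 of u n.+1, and the factor 4 of hip_bound makes this a change
    by at most half of that value. *)
Lemma adjop_bounded T : exists2 c, 0 <= c & opbound T c.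
Proof.
apply: contrapT => unb.
have large c : 0 <= c -> exists y, nrm y <= 1 /\ c < nrm (T y).
  move=> c0; apply: contrapT => no; apply: unb; exists c => // x.
  have [x0|x0] := eqVneq (nrm x) 0.
    by rewrite x0 mulr0 (nrm_eq0 x0) adjop0 nrm0.
  have p0 : 0 < nrm x by rewrite lt_def nrm_ge0 x0.
  rewrite leNgt; apply/negP => lt; apply: no.
  exists ((nrm x)^-1%:C *: x); rewrite adjopZ !nrmZr ?invr_ge0 ?nrm_ge0 //.
  by rewrite mulVf // mulrC ltr_pdivlMr.
have /choice [y yP] : forall n : nat, exists y, nrm y <= 1 /\ 18 ^+ n < nrm (T y).
  by move=> n; apply: large; rewrite exprn_ge0.
pose t n := nrm (T (y n)); pose q : R := 9^-1.
have q0 n : 0 < q ^+ n by rewrite exprn_gt0 // invr_gt0.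
have t0 n : 0 < t n by apply: lt_trans (proj2 (yP n)); rewrite exprn_gt0.
pose xi n := (q ^+ n / t n)%:C *: T (y n); pose f n x := nrm (hip (T (y n)) x).
have c0 n : 0 <= q ^+ n / t n by rewrite divr_ge0 // ltW.
have xiE n : nrm (xi n) = q ^+ n.
  by rewrite nrmZr // -/(t n) -mulrA mulVf ?mulr1 // gt_eqF.
have fxiE n : f n (xi n) = q ^+ n * t n.
  rewrite /f hipZr nrmZr // -nrm_sqr -/(t n) expr2 mulrA -[_ / _ * _]mulrA.
  by rewrite mulVf ?mulr1 // gt_eqF.
(* One of the two steps from x makes the n-th functional at least as large as
   it is at the step itself, since twice the step is their difference. *)
pose step n x := if f n (xi n) <= f n (x + xi n) then x + xi n else x - xi n.
have stepP n x : q ^+ n * t n <= f n (step n x).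
  rewrite -fxiE /step; case: ifPn => // /negbTE; rewrite leNgt => /negbFE lt.
  have : f n (2%:R%:C *: xi n) <= f n (x + xi n) + f n (x - xi n).
    rewrite /f (_ : 2%:R%:C *: xi n = (x + xi n) - (x - xi n)).
      by rewrite hipDr hipNr nrmB.
    rewrite opprB addrC addrA subrK -mulr2n -[RHS]scaler_nat; congr (_ *: _).
    by rewrite rmorph_nat.
  rewrite {1}/f hipZr nrmZr // -/(f n (xi n)) => h; lra.
have stepB n x : nrm (step n x - x) <= q ^+ n.
  by rewrite /step; case: ifP => _; rewrite addrAC subrr add0r ?nrmN xiE.
pose u := fix u n := if n is m.+1 then step m (u m) else 0.
have uB n m : (n <= m)%N -> nrm (u m - u n) <= 9 / 8 * (q ^+ n - q ^+ m).
  move=> /subnKC <-; elim: (m - n)%N => [|d IH].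
    by rewrite addn0 !subrr nrm0 mulr0.
  rewrite addnS; apply: le_trans (nrm_dist (u (n + d)%N) _ _) _.
  have := stepB (n + d)%N (u (n + d)%N); rewrite -/(u (n + d).+1) exprS.
  by move: IH; rewrite /q; lra.
have small e : 0 < e -> exists N, 9 / 8 * q ^+ N < e.
  move=> e0; have /archi_boundP := ltW (divr_gt0 (ltr0n R 2) e0).
  set N := Num.bound _ => hN; exists N.
  have h : N%:R < (9 ^+ N : R) by rewrite -natrX ltr_nat ltn_expl.
  have h9 : 0 < (9 ^+ N : R) by rewrite exprn_gt0.
  rewrite exprVn -[_ * _]/(_ / _) ltr_pdivrMr //.
  move: hN; rewrite ltr_pdivrMr // mulrC => hN.
  by have := ltr_pM2l e0 N%:R (9 ^+ N); rewrite h => h'; lra.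
have [l ul] : exists l : H, u n @[n --> \oo] --> l.
  apply: cauchy_nrm_cvg => e /small[N hN]; exists N => n Nn.
  apply: le_lt_trans (uB _ _ Nn) _; apply: le_lt_trans hN.
  by rewrite ler_pM2l // lerBlDr lerDl ltW.
have lP n : nrm (l - u n.+1) <= q ^+ n / 8.
  apply: (cvg_nrm_le ul); exists n.+1 => m nm; apply: le_trans (uB _ _ nm) _.
  by have := q0 m; rewrite exprS /q; lra.
pose b := nrm (adj T l).
have /archi_boundP : 0 <= 8 * b by rewrite mulr_ge0 ?nrm_ge0.
set n := Num.bound _ => hn.
have fl : f n l <= 4 * b.
  rewrite /f adjE; apply: le_trans (hip_bound _ _) _; rewrite ler_pM2l //.
  by rewrite ler_piMl ?nrm_ge0 //; case: (yP n).
have fu : q ^+ n * t n <= f n (u n.+1) by exact: stepP.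
have fd : f n (u n.+1) <= f n l + 4 * (t n * (q ^+ n / 8)).
  rewrite {1}/f -[u n.+1](subrK l) [_ + l]addrC hipDr; apply: le_trans (nrmD _ _) _.
  rewrite lerD2l; apply: le_trans (hip_bound _ _) _.
  by rewrite ler_pM2l // ler_pM2l ?t0 // nrmC lP.
have h2 : 2 ^+ n < q ^+ n * t n.
  by rewrite mulrC exprVn ltr_pdivlMr ?exprn_gt0 // -exprMn -natrM; case: (yP n).
have : n%:R < (2 ^+ n : R) by rewrite -natrX ltr_nat ltn_expl.
move: fd; rewrite (_ : 4 * _ = 2^-1 * (q ^+ n * t n)); first by lra.
by field.
Qed.

End OperatorAlgebra.
(** * Norm bounds and limits of operators *)

Section OperatorBounds.
Variables (R : realType) (A : cstarAlgType R) (H : hilbertModType A).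
Implicit Types (x y z : H) (S T U : adjop H) (k : R[i]) (c d r : R).
Local Open Scope complex_scope.

Lemma opboundW T c d : c <= d -> opbound T c -> opbound T d.
Proof. by move=> cd h x; apply: le_trans (h x) _; rewrite ler_wpM2r ?nrm_ge0. Qed.

Lemma opbound0 : opbound (0 : adjop H) 0.
Proof. by move=> x; rewrite mul0r nrm0. Qed.

Lemma opbound_eq0 T : opbound T 0 -> T = 0.
Proof.
move=> h; apply: adjop_ext => x; apply: nrm_eq0; apply/eqP.
by rewrite eq_le nrm_ge0 andbT; have := h x; rewrite mul0r.
Qed.

Lemma opboundD S T c d : opbound S c -> opbound T d -> opbound (S + T) (c + d).
Proof.
by move=> hS hT x; apply: le_trans (nrmD _ _) _; rewrite mulrDl lerD.
Qed.

Lemma opboundM S T c d :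
  0 <= c -> opbound S c -> opbound T d -> opbound (S * T) (c * d).
Proof.
move=> c0 hS hT x; apply: le_trans (hS (T x)) _.
by rewrite -mulrA ler_wpM2l.
Qed.

Lemma opboundZ T c d : 0 <= d -> opbound T c -> opbound (d%:C *: T) (d * c).
Proof. by move=> d0 h x; rewrite nrmZr // -mulrA ler_wpM2l. Qed.

(** |T^* x|^2 = |<x, T T^* x>| <= 4 |x| c |T^* x|. *)
Lemma opbound_adj T c : 0 <= c -> opbound T c -> opbound (adj T) (4 * c).
Proof.
move=> c0 h x; have [x0|x0] := eqVneq (nrm (adj T x)) 0.
  by rewrite x0 !mulr_ge0 ?nrm_ge0.
have p0 : 0 < nrm (adj T x) by rewrite lt_def nrm_ge0 x0.
rewrite -(ler_pM2l p0) -expr2 nrm_sqr -adjE.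
apply: le_trans (hip_bound _ _) _.
rewrite (_ : nrm _ * (_ * _) = 4 * (c * nrm (adj T x) * nrm x)); last by ring.
by rewrite ler_pM2l // ler_wpM2r ?nrm_ge0.
Qed.

Lemma adjop_cvg T (u : nat -> H) l :
  u n @[n --> \oo] --> l -> T (u n) @[n --> \oo] --> T l.
Proof.
have [c _ h] := adjop_bounded T.
exact: (additive_bounded_cvg (@adjopD _ _ _ T) h).
Qed.

Lemma cvg_uniq (u : nat -> H) x y :
  u n @[n --> \oo] --> x -> u n @[n --> \oo] --> y -> x = y.
Proof. exact: (cvg_unique (@norm_hausdorff _ _)). Qed.

Lemma opbound_lim (W : nat -> adjop H) T c :
  (forall n, opbound (W n) c) -> (forall x, W n x @[n --> \oo] --> T x) ->
  opbound T c.
Proof.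
move=> h cv x; rewrite -[T x]subr0; apply: cvg_nrm_le (cv x) _.
by exists 0%N => n _; rewrite subr0 h.
Qed.

Lemma cvg_opM (W W' : nat -> adjop H) T T' c :
  0 <= c -> (forall n, opbound (W n) c) ->
  (forall x, W n x @[n --> \oo] --> T x) ->
  (forall x, W' n x @[n --> \oo] --> T' x) ->
  forall x, (W n * W' n) x @[n --> \oo] --> (T * T') x.
Proof.
move=> c0 h cW cW' x; apply/cvg_nrmP => e e0.
have d0 : 0 < e / 2 / (c + 1) by rewrite !divr_gt0 // ltr_wpDl.
have /cvg_nrmP /(_ _ d0) [N1 N1P] := cW' x.
have /cvg_nrmP /(_ (e / 2)) [|N2 N2P] := cW (T' x); first by rewrite divr_gt0.
exists (maxn N1 N2) => n; rewrite geq_max => /andP[/N1P n1 /N2P n2].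
rewrite [e]splitr; apply: le_lt_trans (nrm_dist (W n (T' x)) _ _) _.
apply: ltrD => //=; rewrite -adjopB; apply: le_lt_trans (h n _) _.
move: n1; rewrite ltr_pdivlMr ?ltr_wpDl //; apply: le_lt_trans.
by rewrite mulrC ler_wpM2l ?nrm_ge0 // lerDl.
Qed.

(** The increments of w dominate those of W, so W is Cauchy at each vector as w
    is; self-adjointness passes to the limit and makes it adjointable. *)
Lemma selfadj_lim (W : nat -> adjop H) (w : nat -> R) d :
  (forall n, adj (W n) = W n) -> (forall n, w n <= d) ->
  (forall m n, (m <= n)%N -> opbound (W n - W m) (w n - w m)) ->
  exists2 T, adj T = T & forall x, W n x @[n --> \oo] --> T x.
Proof.
move=> sa wd wb.
have sup_w : has_sup (range w).
  by split; [exists (w 0%N), 0%N | exists d => _ [n _ <-]].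
have cauchy e : 0 < e -> exists N, forall n, w n - w N < e.
  move=> e0; have [_ [N _ <-] h] := sup_adherent e0 sup_w.
  exists N => n; rewrite ltrBlDl; move: h; rewrite ltrBlDr; apply: le_lt_trans.
  by apply: sup_ubound; [case: sup_w | exists n].
have lim x : exists y : H, W n x @[n --> \oo] --> y.
  apply: cauchy_nrm_cvg => e e0.
  have d0 : 0 < e / (nrm x + 1) by rewrite divr_gt0 // ltr_wpDl ?nrm_ge0.
  have [N NP] := cauchy _ d0; exists N => n Nn.
  apply: le_lt_trans (wb N n Nn x) _.
  have := NP n; rewrite ltr_pdivlMr ?ltr_wpDl ?nrm_ge0 //.
  have [wneg|wpos] := leP (w n - w N) 0 => h.
    by apply: le_lt_trans e0; rewrite mulr_le0_ge0 ?nrm_ge0.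
  by apply: le_lt_trans h; rewrite ler_pM2l // lerDl.
have [f fP] := choice lim.
have sym x y : hip (f x) y = hip x (f y).
  apply: (cvg_unique (@norm_hausdorff _ _)) (hip_cvgl (fP x)) _ => //.
  rewrite (_ : (fun n => _) = (fun n => hip x (W n y))).
    exact: (hip_cvgr (fP y)).
  by apply/funext => n; rewrite adjE sa.
by exists (Adjop sym); [apply: adjop_ext | ].
Qed.

End OperatorBounds.

(** * Square roots *)

Section SquareRoot.
Variables (R : realType) (A : cstarAlgType R) (H : hilbertModType A).
Implicit Types (x y z : H) (S T U Y : adjop H) (k : R[i]) (c d r : R).
Local Open Scope complex_scope.

(** Iteration of T |-> (Y + T^2) / 2, whose fixed points satisfy
    (1 - T)^2 = 1 - Y. *)
Fixpoint root_seq Y n : adjop H :=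
  if n is m.+1 then (2^-1 : R)%:C *: (Y + root_seq Y m * root_seq Y m) else 0.

(** [dominated Y S c] holds when S is a polynomial in Y without constant term,
    with nonnegative coefficients of sum c.  If |Y| <= 1 this bounds S by c, even
    where the iteration is not a contraction. *)
Inductive dominated Y : adjop H -> R -> Prop :=
| dom0 : dominated Y 0 0
| domY : dominated Y Y 1
| domD S T c d : dominated Y S c -> dominated Y T d -> dominated Y (S + T) (c + d)
| domM S T c d : dominated Y S c -> dominated Y T d -> dominated Y (S * T) (c * d)
| domZ S c d : 0 <= d -> dominated Y S c -> dominated Y (d%:C *: S) (d * c).

Lemma dominated_intertwine Y T S c :
  T * Y = Y * T -> dominated Y S c -> T * S = S * T.
Proof.
move=> TY; elim=> {S c} [|//|S S' c d _ hS _ hS'|S S' c d _ hS _ hS'|S c d _ _ hS].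
- by rewrite mulr0 mul0r.
- by rewrite mulrDr mulrDl hS hS'.
- by rewrite mulrA hS -mulrA hS' mulrA.
- by rewrite -adjop_scaleAr -adjop_scaleAl hS.
Qed.

Lemma dominated_comm Y S T c d :
  dominated Y S c -> dominated Y T d -> S * T = T * S.
Proof.
move=> hS hT; apply: dominated_intertwine hT; symmetry.
exact: dominated_intertwine hS.
Qed.

Lemma dominated_ge0 Y S c : dominated Y S c -> 0 <= c.
Proof.
by elim=> {S c} // [S T c d _ c0 _ d0|S T c d _ c0 _ d0|S c d d0 _ c0];
  [rewrite addr_ge0 | rewrite mulr_ge0 | rewrite mulr_ge0].
Qed.

Lemma dominated_selfadj Y S c : adj Y = Y -> dominated Y S c -> adj S = S.
Proof.
move=> sY; elim=> {S c} [|//|S T c d _ hS _ hT|S T c d dS hS dT hT|S c d _ _ hS].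
- exact: adj0.
- by rewrite adjD hS hT.
- by rewrite adjM hS hT (dominated_comm dS dT).
- by rewrite adjZr hS.
Qed.

Lemma dominated_opbound Y S c :
  opbound Y 1 -> dominated Y S c -> opbound S c.
Proof.
move=> bY; elim=> {S c} [|//|S T c d _ hS _ hT|S T c d dS hS dT hT|S c d d0 _ hS].
- exact: opbound0.
- exact: opboundD.
- by apply: opboundM => //; apply: dominated_ge0 dS.
- exact: opboundZ.
Qed.

Fixpoint root_bound n : R :=
  if n is m.+1 then 2^-1 * (1 + root_bound m * root_bound m) else 0.

Lemma root_bound_ge0 n : 0 <= root_bound n.
Proof.
by elim: n => //= n IH; rewrite mulr_ge0 ?invr_ge0 // addr_ge0 ?mulr_ge0.
Qed.

Lemma root_bound_le1 n : root_bound n <= 1.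
Proof. by elim: n => //= n IH; have := root_bound_ge0 n; nra. Qed.

Lemma root_seq_dominated Y n : dominated Y (root_seq Y n) (root_bound n).
Proof.
elim: n => [|n IH]; first exact: dom0.
by apply: domZ; rewrite ?invr_ge0 //; apply: domD (domY _) (domM IH IH).
Qed.

(** Up to the factor 1/2 the next increment is the product of the present one
    with the sum of the two terms. *)
Lemma root_seq_incr Y n :
  dominated Y (root_seq Y n.+1 - root_seq Y n) (root_bound n.+1 - root_bound n).
Proof.
elim: n => [|n IH].
  rewrite !subr0 /= !mulr0 !addr0; apply: domZ (domY _).
  by rewrite invr_ge0.
have dn := root_seq_dominated Y n; have dn1 := root_seq_dominated Y n.+1.
have -> : root_seq Y n.+2 - root_seq Y n.+1 = (2^-1 : R)%:C *:
    ((root_seq Y n.+1 - root_seq Y n) * (root_seq Y n.+1 + root_seq Y n)).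
  set S := root_seq Y n.+1; set T := root_seq Y n.
  rewrite [X in X - _](_ : _ = (2^-1 : R)%:C *: (Y + S * S)) //.
  rewrite [X in _ - X](_ : _ = (2^-1 : R)%:C *: (Y + T * T)) // -scalerBr.
  congr (_ *: _); rewrite mulrDr !mulrBl (dominated_comm dn1 dn : S * T = T * S).
  by rewrite addrA subrK opprD addrACA subrr add0r.
have -> : root_bound n.+2 - root_bound n.+1 = 2^-1 *
    ((root_bound n.+1 - root_bound n) * (root_bound n.+1 + root_bound n)).
  by rewrite [root_bound n.+2]/= [X in _ - X]/= -mulrBr -/(root_bound n.+1); ring.
by apply: domZ; [rewrite invr_ge0 | apply: domM => //; apply: domD].
Qed.

Lemma root_seq_dist Y m n : (m <= n)%N ->
  dominated Y (root_seq Y n - root_seq Y m) (root_bound n - root_bound m).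
Proof.
move=> /subnKC <-; elim: (n - m)%N => [|d IH].
  by rewrite addn0 !subrr; apply: dom0.
have := domD (root_seq_incr Y (m + d)) IH.
by rewrite !addrA !subrK addnS.
Qed.

Lemma root_seq_cvg Y : adj Y = Y -> opbound Y 1 ->
  exists T, [/\ adj T = T, opbound T 1, T + T = Y + T * T &
                forall x, root_seq Y n x @[n --> \oo] --> T x].
Proof.
move=> sY bY.
have sa n : adj (root_seq Y n) = root_seq Y n.
  exact: dominated_selfadj sY (root_seq_dominated Y n).
have bd n : opbound (root_seq Y n) 1.
  apply: opboundW (root_bound_le1 n) _.
  exact: dominated_opbound bY (root_seq_dominated Y n).
have [|T sT cT] := selfadj_lim sa root_bound_le1.
  by move=> m n mn; apply: dominated_opbound bY (root_seq_dist Y mn).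
exists T; split => //; first exact: opbound_lim bd cT.
have half : T = (2^-1 : R)%:C *: (Y + T * T).
  apply: adjop_ext => x; apply: (@cvg_uniq _ _ _ (fun n => root_seq Y n.+1 x)).
    by have := cT x; rewrite -(cvg_shiftS (fun n => root_seq Y n x)).
  have /= h := @additive_bounded_cvg _ H H (fun y => (2^-1 : R)%:C *: y) 2^-1.
  apply: h => [u v|u|]; first by rewrite scalerDr.
    by rewrite nrmZr ?invr_ge0.
  apply: cvgD; first exact: cvg_cst.
  exact: (cvg_opM ler01 bd cT cT).
rewrite [in LHS]half -scalerDl -rmorphD /= (_ : 2^-1 + 2^-1 = 1) ?scale1r //.
by field.
Qed.

Lemma root_seq_intertwine Y Y' T n :
  T * Y = Y' * T -> T * root_seq Y n = root_seq Y' n * T.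
Proof.
move=> TY; elim: n => [|n IH] /=; first by rewrite mulr0 mul0r.
by rewrite -adjop_scaleAr -adjop_scaleAl mulrDr mulrDl TY mulrA IH -!mulrA IH.
Qed.

Definition scal c : adjop H := c%:C *: (1 : adjop H).

Lemma scalE c x : scal c x = c%:C *: x. Proof. by []. Qed.

Lemma adj_scal c : adj (scal c) = scal c.
Proof. by rewrite adjZr adj1. Qed.

Lemma scalM c T : scal c * T = c%:C *: T.
Proof. by rewrite /scal -adjop_scaleAl mul1r. Qed.

Lemma mul_scal c T : T * scal c = c%:C *: T.
Proof. by rewrite /scal -adjop_scaleAr mulr1. Qed.

Lemma opbound_scal c : 0 <= c -> opbound (scal c) c.
Proof. by move=> c0 x; rewrite nrmZr. Qed.

(** With Y := 1 - S / c and T the limit of the iteration, the root is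
    sqrt c (1 - T).  One root function serves all operators with the same c, so
    that an operator intertwining two of them also intertwines their roots. *)
Lemma sqrt_op c : 0 < c ->
  exists rt : adjop H -> adjop H,
    (forall S, adj S = S -> opbound (scal c - S) c ->
       [/\ adj (rt S) = rt S, rt S * rt S = S &
           opbound (scal (Num.sqrt c) - rt S) (Num.sqrt c)]) /\
    (forall S S' T, adj S = S -> opbound (scal c - S) c ->
       adj S' = S' -> opbound (scal c - S') c ->
       T * S = S' * T -> T * rt S = rt S' * T).
Proof.
move=> c0; pose Y S := 1 - c^-1%:C *: S : adjop H.
have c1 : c * c^-1 = 1 by rewrite divff // gt_eqF.
have sY S : adj S = S -> adj (Y S) = Y S by move=> sS; rewrite adjB adj1 adjZr sS.
have bY S : opbound (scal c - S) c -> opbound (Y S) 1.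
  have -> : Y S = c^-1%:C *: (scal c - S).
    by rewrite scalerBr scalerA -rmorphM /= mulrC c1 scale1r.
  move=> /(@opboundZ _ _ _ _ _ c^-1); rewrite mulrC c1; apply.
  by rewrite invr_ge0 ltW.
have ex S : exists L, adj S = S -> opbound (scal c - S) c ->
    [/\ adj L = L, opbound L 1, L + L = Y S + L * L &
        forall x, root_seq (Y S) n x @[n --> \oo] --> L x].
  have [[sS bS]|no] := pselect (adj S = S /\ opbound (scal c - S) c).
    by have [L LP] := root_seq_cvg (sY _ sS) (bY _ bS); exists L.
  by exists 0 => sS bS; case: no.
have [L LP] := choice ex.
exists (fun S => (Num.sqrt c)%:C *: (1 - L S)).
split=> [S sS bS|S S' T sS bS sS' bS' TS].
  have [sL bL eL _] := LP _ sS bS; split.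
  - by rewrite adjZr adjB adj1 sL.
  - rewrite -adjop_scaleAl -adjop_scaleAr scalerA -rmorphM /= -expr2 sqr_sqrtr ?ltW //.
    rewrite mulrBl !mulrBr !mul1r mulr1 opprB.
    have -> : (1 - L S) + (L S * L S - L S) = c^-1%:C *: S; last first.
      by rewrite scalerA -rmorphM /= c1 scale1r.
    rewrite addrACA -opprD eL opprD addrACA subrr addr0.
    by rewrite /Y opprB addrC subrK.
  - rewrite scalerBr opprB addrC subrK.
    by rewrite -[X in opbound _ X]mulr1; apply: opboundZ; rewrite ?sqrtr_ge0.
have [_ _ _ cL] := LP _ sS bS; have [_ _ _ cL'] := LP _ sS' bS'.
rewrite -adjop_scaleAr -adjop_scaleAl; congr (_ *: _).
rewrite mulrBr mulrBl mulr1 mul1r; congr (_ - _).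
have TY : T * Y S = Y S' * T.
  by rewrite mulrBr mulrBl mulr1 mul1r -adjop_scaleAr -adjop_scaleAl TS.
apply: adjop_ext => x.
apply: cvg_uniq (adjop_cvg (T := T) (cL x)) _.
rewrite (_ : (fun n => _) = (fun n => root_seq (Y S') n (T x))); first exact: cL'.
apply/funext => n.
exact: (congr1 (fun U : adjop H => U x) (root_seq_intertwine n TY)).
Qed.

End SquareRoot.
(** * The positive cone of L(H) *)

Section PositiveCone.
Variables (R : realType) (A : cstarAlgType R) (H : hilbertModType A).
Implicit Types (x y z : H) (S T U a b h p q : adjop H) (k : R[i]) (c d r : R).
Local Open Scope complex_scope.

(** These are the positive elements: the spectrum of a self-adjoint h is
    nonnegative iff it lies in the interval [0, 2 c] for some c. *)
Definition poscone h :=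
  adj h = h /\ exists2 c, 0 < c & opbound (scal H c - h) c.

Lemma scalD c d : scal H (c + d) = scal H c + scal H d.
Proof. by rewrite /scal -scalerDl -rmorphD. Qed.

Lemma opbound_scal_sub c d h : c <= d ->
  opbound (scal H c - h) c -> opbound (scal H d - h) d.
Proof.
move=> cd hc; rewrite -(subrK c d) scalD -addrA; apply: opboundD hc.
by apply: opbound_scal; rewrite subr_ge0.
Qed.

Lemma poscone_add h p : poscone h -> poscone p -> poscone (h + p).
Proof.
move=> [sh [c c0 hc]] [sp [d d0 pd]]; split; first by rewrite adjD sh sp.
exists (c + d); first by rewrite addr_gt0.
by rewrite scalD opprD addrACA; apply: opboundD.
Qed.

Lemma poscone_sqrt h : poscone h ->
  exists q, [/\ poscone q, q * q = h & forall b, b * h = h * b -> b * q = q * b].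
Proof.
move=> [sh [c c0 hc]]; have [rt [rtP rtC]] := sqrt_op H c0.
have [s e b] := rtP h sh hc; exists (rt h); split => //; last first.
  by move=> T; apply: rtC.
by split => //; exists (Num.sqrt c); rewrite // sqrtr_gt0.
Qed.

(** The operators a + ik and a - ik are adjoint to each other and multiply to
    m ^+ 2, hence are m times isometries; so k, half of their difference, has
    norm at most m. *)
Lemma sumsq_opbound a h m : adj a = a -> adj h = h -> a * h = h * a ->
  0 <= m -> a * a + h * h = scal H (m ^+ 2) -> opbound h m.
Proof.
move=> sa sh ah m0 e x.
pose W := a + 'i%C *: h; pose W' := a - 'i%C *: h.
have aW : adj W = W' by rewrite adjD adjZi sa sh.
have aW' : adj W' = W by rewrite -aW adjK.
have ii : 'i%C *: ('i%C *: (h * h)) = - (h * h).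
  by rewrite scalerA (_ : 'i%C * 'i%C = -1 :> R[i]) ?scaleN1r // -expr2 sqr_i.
have W'W : W' * W = scal H (m ^+ 2).
  rewrite mulrDl mulNr !mulrDr -!adjop_scaleAl -!adjop_scaleAr ii ah.
  by rewrite opprB addrACA subrr addr0.
have WW' : W * W' = scal H (m ^+ 2).
  rewrite mulrDl !mulrBr -!adjop_scaleAl -!adjop_scaleAr ii ah.
  by rewrite opprK addrA subrK.
have iso V V' : adj V = V' -> V' * V = scal H (m ^+ 2) -> nrm (V x) = m * nrm x.
  move=> sV VV; apply/eqP; rewrite -(@eqrXn2 _ 2) ?nrm_ge0 ?mulr_ge0 ?nrm_ge0 //.
  rewrite nrm_sqr adjE sV -[V' (V x)]/((V' * V) x) VV scalE hipZr nrmZr ?sqr_ge0 //.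
  by rewrite -nrm_sqr exprMn.
have := nrmB (W x) (W' x).
rewrite (iso W W') // (iso W' W) //.
have -> : W x - W' x = (2%:R : R)%:C *: ('i%C *: h x).
  by rewrite /= opprB addrC addrA subrK -mulr2n -[LHS]scaler_nat rmorph_nat.
by rewrite nrmZr // nrmZi; lra.
Qed.

(** If |a| <= m, then m^2 - a^2 has a root q commuting with a, and q is bounded by
    m because a^2 + q^2 = m^2; hence m^2 - a^2 = q^2 is bounded by m^2. *)
Lemma poscone_sqr a : adj a = a -> poscone (a * a).
Proof.
move=> sa; have [c c0 ac] := adjop_bounded a.
pose m := c + 1; have m0 : 0 < m by rewrite ltr_wpDl.
have am : opbound a m by apply: opboundW ac; rewrite lerDl.
have saa : adj (a * a) = a * a by rewrite adjM sa.
split=> //; exists (m ^+ 2); first by rewrite exprn_gt0.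
have [|q [[sq _] qq qC]] := @poscone_sqrt (scal H (m ^+ 2) - a * a).
  split; first by rewrite adjB adj_scal saa.
  exists (m ^+ 2); first by rewrite exprn_gt0.
  rewrite opprB addrC subrK expr2; by apply: (opboundM _ am am); apply: ltW.
have aq : a * q = q * a.
  by apply: qC; rewrite mulrBr mulrBl scalM mul_scal mulrA.
have qm : opbound q m.
  by apply: sumsq_opbound sa sq aq (ltW m0) _; rewrite qq addrC subrK.
by rewrite -qq expr2; apply: opboundM; rewrite ?ltW.
Qed.

(** If h = q^2 and - h = p^2, then q^2 + p^2 = 0 with q and p commuting. *)
Lemma poscone_antisym h : poscone h -> poscone (- h) -> h = 0.
Proof.
move=> /poscone_sqrt[q [[sq _] qq qC]] /poscone_sqrt[p [[sp _] pp pC]].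
have hq : h * q = q * h by rewrite -qq mulrA.
have pq : q * p = p * q by apply: pC; rewrite mulrN mulNr hq.
have b0 : opbound p 0.
  apply: sumsq_opbound sq sp pq _ _ => //.
  by rewrite qq pp subrr /scal expr0n /= scale0r.
by rewrite -[h]opprK -pp (opbound_eq0 b0) mulr0 oppr0.
Qed.

Lemma adjM_eq0 T : adj T * T = 0 -> T = 0.
Proof.
move=> e; apply: adjop_ext => x; apply: hip_eq0.
by rewrite adjE -[adj T (T x)]/((adj T * T) x) e hip0r.
Qed.

(** The element is (T + T^* )^2 + (i (T - T^* ))^2. *)
Lemma poscone_adjM_sum T :
  poscone (adj T * T + T * adj T + (adj T * T + T * adj T)).
Proof.
have -> : adj T * T + T * adj T + (adj T * T + T * adj T) =
    (T + adj T) * (T + adj T) + ('i%C *: (T - adj T)) * ('i%C *: (T - adj T)).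
  rewrite -adjop_scaleAl -adjop_scaleAr scalerA.
  rewrite (_ : 'i%C * 'i%C = -1 :> R[i]) ?scaleN1r; last by rewrite -expr2 sqr_i.
  have -> : (T + adj T) * (T + adj T)
      = T * T + adj T * adj T + (adj T * T + T * adj T).
    rewrite mulrDl !mulrDr [adj T * T + adj T * _]addrC addrACA.
    by rewrite [T * adj T + _]addrC.
  have -> : (T - adj T) * (T - adj T)
      = T * T + adj T * adj T - (adj T * T + T * adj T).
    by rewrite mulrBl !mulrBr opprB addrACA -opprD [T * adj T + _]addrC.
  by rewrite opprB [X in _ = X + _]addrC [RHS]addrACA subrr addr0.
apply: poscone_add; apply: poscone_sqr; first by rewrite adjD adjK addrC.
by rewrite adjZi adjB adjK -scalerN opprB.
Qed.

(** The negative part of h := T^* T is shown to vanish.  With r := sqrt (h^2)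
    and u := r - h, which is twice that part, T u = u' T where u' is built from
    h' := T T^* in the same way.  So for y := T u both y^* y = u h u and
    y y^* = u' h' u' are minus squares, whereas twice their sum is the sum of the
    squares of the self-adjoint operators y + y^* and i (y - y^* ).  Hence these
    squares are 0, and u h u = 0 forces u = 0. *)
Theorem poscone_adjM T : poscone (adj T * T).
Proof.
pose h := adj T * T; pose h' := T * adj T.
have sh : adj h = h by rewrite adjM adjK.
have sh' : adj h' = h' by rewrite adjM adjK.
have Th : T * h = h' * T by rewrite mulrA.
have [_ [c c0 hc]] := poscone_sqr sh; have [_ [d d0 hd]] := poscone_sqr sh'.
pose m := c + d; have m0 : 0 < m by rewrite addr_gt0.
have [rt [rtP rtC]] := sqrt_op H m0.
have shh : adj (h * h) = h * h by rewrite adjM sh.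
have shh' : adj (h' * h') = h' * h' by rewrite adjM sh'.
have hm : opbound (scal H m - h * h) m.
  by apply: opbound_scal_sub hc; rewrite lerDl ltW.
have hm' : opbound (scal H m - h' * h') m.
  by apply: opbound_scal_sub hd; rewrite lerDr ltW.
pose r := rt (h * h); pose r' := rt (h' * h').
have [sr rr br] : [/\ adj r = r, r * r = h * h &
    opbound (scal H (Num.sqrt m) - r) (Num.sqrt m)] by apply: rtP.
have [sr' rr' br'] : [/\ adj r' = r', r' * r' = h' * h' &
    opbound (scal H (Num.sqrt m) - r') (Num.sqrt m)] by apply: rtP.
have sm0 : 0 < Num.sqrt m by rewrite sqrtr_gt0.
have pr : poscone r by split => //; exists (Num.sqrt m).
have pr' : poscone r' by split => //; exists (Num.sqrt m).
have hr : h * r = r * h by apply: rtC; rewrite // mulrA.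
have hr' : h' * r' = r' * h' by apply: rtC; rewrite // mulrA.
have Tr : T * r = r' * T by apply: rtC; rewrite // mulrA Th -mulrA Th mulrA.
pose u := r - h; pose u' := r' - h'.
have Tu : T * u = u' * T by rewrite mulrBr mulrBl Th Tr.
(* For g = h or h' and s its absolute value, s - g is twice the negative part of
   g; the square root of s times s - g is the v below. *)
have neg (g s : adjop H) : adj g = g -> g * s = s * g -> s * s = g * g ->
    poscone s -> exists v, [/\ adj v = v,
      (s - g) * g * (s - g) = - (v * v) & v = 0 -> s = g].
  move=> sg gs ss ps; have [q [[sq _] qq qC]] := poscone_sqrt ps.
  have [sS _] := ps.
  have gq : g * q = q * g by apply: qC.
  have sq' : s * q = q * s by rewrite -qq mulrA.
  have sB : adj (s - g) = s - g by rewrite adjB sS sg.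
  have sgq : (s - g) * q = q * (s - g) by rewrite mulrBl mulrBr gq sq'.
  have gv : g * (s - g) = - (s * (s - g)).
    by rewrite !mulrBr gs ss opprB.
  exists (q * (s - g)); split.
  - by rewrite adjM sB sq sgq.
  - rewrite -mulrA gv mulrN; congr (- _).
    by rewrite -{1}sgq -mulrA [q * (q * _)]mulrA qq.
  - move=> v0; have sv : s * (s - g) = 0 by rewrite -{1}qq -mulrA v0 mulr0.
    apply/eqP; rewrite -subr_eq0; apply/eqP/adjM_eq0.
    by rewrite sB mulrBl gv sv oppr0 subrr.
have [v [sv vu v0]] := neg h r sh hr rr pr.
have [v' [sv' vu' _]] := neg h' r' sh' hr' rr' pr'.
have su : adj u = u by rewrite adjB sr sh.
have su' : adj u' = u' by rewrite adjB sr' sh'.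
pose y := T * u; pose w := v * v + v' * v'.
have pw := poscone_add (poscone_sqr sv) (poscone_sqr sv').
have yE : adj y * y + y * adj y = - w.
  rewrite [adj y * y](_ : _ = - (v * v)); last first.
    by rewrite -vu /y adjM su -!mulrA.
  rewrite [y * adj y](_ : _ = - (v' * v')) ?opprD //.
  by rewrite -vu' /y Tu adjM su' -!mulrA.
have ww0 : w + w = 0.
  apply: poscone_antisym; first exact: poscone_add.
  by rewrite opprD -yE; apply: poscone_adjM_sum.
have w0 : w = 0.
  have : (2^-1 : R)%:C *: (w + w) = 0 by rewrite ww0 scaler0.
  by rewrite scalerDr -scalerDl -rmorphD /= (_ : 2^-1 + 2^-1 = 1) ?scale1r //; field.
have vv0 : v * v = 0.
  apply: poscone_antisym; first exact: poscone_sqr.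
  suff -> : - (v * v) = v' * v' by apply: poscone_sqr.
  by apply/eqP; rewrite eq_sym -addr_eq0 addrC; apply/eqP.
suff -> : adj T * T = r by [].
by symmetry; apply: v0; apply: adjM_eq0; rewrite sv.
Qed.

End PositiveCone.
(** * Closures of ranges and resolvents *)

Section Ranges.
Variables (R : realType) (A : cstarAlgType R) (H : hilbertModType A).
Implicit Types (x y z : H) (S T U E F B : adjop H) (M N : set H) (c d e : R).
Local Open Scope complex_scope.

Lemma closure_map S M N x :
  (forall y, M y -> N (S y)) -> closure M x -> closure N (S x).
Proof.
move=> MN /closure_nrmP cx; apply/closure_nrmP => e e0.
have [c c0 Sc] := adjop_bounded S.
have d0 : 0 < c + 1 by rewrite ltr_wpDl.
have [|y My xy] := cx (e / (c + 1)); first by rewrite divr_gt0.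
exists (S y); first exact: MN.
rewrite -adjopB; apply: le_lt_trans (Sc _) _.
move: xy; rewrite ltr_pdivlMr //; apply: le_lt_trans.
by rewrite mulrC ler_wpM2l ?nrm_ge0 // lerDl.
Qed.

Lemma closure_seq M x :
  closure M x -> exists2 u : nat -> H, (forall n, M (u n)) & u n @[n --> \oo] --> x.
Proof.
move=> /closure_nrmP cx.
have /choice [u uP] : forall n : nat, exists y, M y /\ nrm (x - y) < n.+1%:R^-1.
  by move=> n; have [|y My xy] := cx n.+1%:R^-1; [rewrite invr_gt0 | exists y].
exists u => [n|]; first by case: (uP n).
apply/cvg_nrmP => e e0.
have /archi_boundP : 0 <= e^-1 by rewrite invr_ge0 ltW.
set N := Num.bound _ => hN; exists N => n Nn; apply: lt_trans (proj2 (uP n)) _.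
rewrite -[e]invrK ltf_pV2 ?posrE ?invr_gt0 //; apply: lt_le_trans hN _.
by rewrite ler_nat leqW.
Qed.

Lemma seq_closure M (u : nat -> H) x :
  (forall n, M (u n)) -> u n @[n --> \oo] --> x -> closure M x.
Proof.
move=> Mu /cvg_nrmP ux; apply/closure_nrmP => e /ux[N NP].
by exists (u N); rewrite ?NP.
Qed.

Lemma orth_closure M z x :
  (forall y, M y -> hip z y = 0) -> closure M x -> hip z x = 0.
Proof.
move=> zM /closure_seq[u uM /(hip_cvgr (y := z)) ux].
apply: (cvg_unique (@norm_hausdorff _ _)) ux _ => //.
rewrite (_ : (fun n => _) = fun=> 0); first exact: cvg_cst.
by apply/funext => n; rewrite zM.
Qed.

Lemma orth_ranP T z : orth (closure (ran T)) z <-> adj T z = 0.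
Proof.
split=> [oz|Tz x].
  apply: hip_inj => y; rewrite hip0r -adjE hip_star oz; last first.
    by apply: subset_closure; exists y.
  by rewrite -(hip0r (0 : H)) -hip_star hip0l.
by apply: orth_closure => _ [y _ <-]; rewrite adjEr Tz hip0l.
Qed.

Lemma closure_ran_eq0 S T x : S * T = 0 -> closure (ran T) x -> S x = 0.
Proof.
move=> ST cx; apply: hip_inj => z; rewrite hip0r adjEr.
apply: orth_closure cx => _ [y _ <-].
by rewrite -adjEr -[S (T y)]/((S * T) y) ST hip0r.
Qed.

Lemma closure_sub M N : (forall x, M x -> closure N x) -> closure M `<=` closure N.
Proof. by move=> MN; have /closure_id -> := @closed_closure _ N; apply: closureS. Qed.

Lemma closure_ranP T : closed_submodule (closure (ran T)).
Proof.
split=> [||x y|k x|x a].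
- exact: closed_closure.
- by apply: subset_closure; exists 0; rewrite // adjop0.
- move=> /closure_seq[u uT ux] /closure_seq[v vT vy].
  apply: (seq_closure (u := fun n => u n + v n)); last exact: cvgD.
  move=> n; have [s _ <-] := uT n; have [t _ <-] := vT n.
  by exists (s + t); rewrite ?adjopD.
- move=> /(closure_map (S := k *: (1 : adjop H))); apply => _ [y _ <-].
  by exists (k *: y); rewrite ?adjopZ.
- move=> /closure_seq[u uT ux].
  apply: (seq_closure (u := fun n => hact (u n) a)) => [n|].
    by have [s _ <-] := uT n; exists (hact s a); rewrite ?adjop_act.
  apply: (additive_bounded_cvg (f := fun y => hact y a) _ _ ux).
    by move=> y z; rewrite hactDl.
  exact: (fun y => nrm_hact y a).
Qed.

Lemma oc_ranP T : orth_complemented (closure (ran T)) <->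
  forall x, exists y z, [/\ closure (ran T) y, adj T z = 0 & x = y + z].
Proof.
split=> [[_ oc] x|oc].
  by have [y [z [cy /orth_ranP oz xE]]] := oc x; exists y, z.
split=> [|x]; first exact: closure_ranP.
by have [y [z [cy oz xE]]] := oc x; exists y, z; split => //; apply/orth_ranP.
Qed.

(** Since |c - T^* T| <= c for some c, the operator T^* T + e equals
    (c + e) - (c - T^* T), which a Neumann series inverts. *)
Lemma resolvent_ex T e : 0 < e ->
  exists Z, [/\ adj Z = Z, (adj T * T + scal H e) * Z = 1 & opbound Z e^-1].
Proof.
move=> e0; have [sT [c c0 cT]] := poscone_adjM T.
have ce0 : 0 < c + e by rewrite addr_gt0.
pose S := (c + e)^-1%:C *: (scal H c - adj T * T).
have sS : adj S = S by rewrite adjZr adjB adj_scal sT.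
pose r := (c + e)^-1 * c.
have r0 : 0 <= r by rewrite mulr_ge0 ?invr_ge0 // ltW.
have r1 : r < 1 by rewrite /r mulrC ltr_pdivrMr // mul1r ltrDl.
have bS : opbound S r by apply: opboundZ; rewrite // invr_ge0 ltW.
pose W := fix W n : adjop H := if n is m.+1 then 1 + S * W m else 0.
pose w := fix w n : R := if n is m.+1 then 1 + r * w m else 0.
have WS n : S * W n = W n * S.
  elim: n => [|n IH] /=; first by rewrite mulr0 mul0r.
  by rewrite mulrDr mulrDl mulr1 mul1r -mulrA IH.
have sW n : adj (W n) = W n.
  elim: n => [|n IH] /=; first exact: adj0.
  by rewrite adjD adj1 adjM IH sS WS.
have incr n : opbound (W n.+1 - W n) (w n.+1 - w n).
  elim: n => [|n IH].
    by rewrite /= !mulr0 !addr0 !subr0 => x; rewrite mul1r.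
  have -> : W n.+2 - W n.+1 = S * (W n.+1 - W n).
    by rewrite /= opprD addrACA subrr add0r -mulrBr.
  have -> : w n.+2 - w n.+1 = r * (w n.+1 - w n) by rewrite /=; ring.
  exact: opboundM.
have dist m n : (m <= n)%N -> opbound (W n - W m) (w n - w m).
  move=> /subnKC <-; elim: (n - m)%N => [|k IH].
    by rewrite addn0 !subrr; apply: opbound0.
  rewrite addnS -(subrKA (W (m + k)%N)) -(subrKA (w (m + k)%N)).
  exact: opboundD.
have wd n : w n <= (1 - r)^-1.
  have r10 : 0 < 1 - r by rewrite subr_gt0.
  elim: n => [|n IH] /=; first by rewrite invr_ge0 ltW.
  apply: le_trans (_ : 1 + r * (1 - r)^-1 <= _); first by rewrite lerD2l ler_wpM2l.
  rewrite le_eqVlt; apply/orP; left; apply/eqP; field.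
  by rewrite subr_eq0 gt_eqF.
have [V sV cV] := selfadj_lim sW wd dist.
have VE : V = 1 + S * V.
  apply: adjop_ext => x; apply: (@cvg_uniq _ _ _ (fun n => W n.+1 x)).
    by have := cV x; rewrite -(cvg_shiftS (fun n => W n x)).
  apply: cvgD; first exact: cvg_cst.
  exact: adjop_cvg.
have TS : adj T * T + scal H e = (c + e)%:C *: (1 - S).
  rewrite scalerBr scalerA -rmorphM /= divff ?gt_eqF // scale1r.
  by rewrite -/(scal H (c + e)) scalD opprB [RHS]addrC addrA subrK.
exists ((c + e)^-1%:C *: V); split.
- by rewrite adjZr sV.
- rewrite TS -adjop_scaleAl -adjop_scaleAr scalerA -rmorphM /= divff ?gt_eqF //.
  by rewrite scale1r mulrBl mul1r {1}VE addrK.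
- move=> x; set z := (_ *: V) x.
  have Vx : V x = x + S (V x) by rewrite {1}VE.
  have zE : (c + e)%:C *: z = x + (scal H c - adj T * T) z.
    rewrite [X in _ = x + X](adjopZ _ (c + e)^-1%:C (V x)).
    rewrite [LHS](scalerA (c + e)%:C (c + e)^-1%:C (V x)) -rmorphM /=.
    by rewrite divff ?gt_eqF // scale1r {1}Vx.
  have /(congr1 (@nrm _ _)) := zE; rewrite (nrmZr _ (ltW ce0)) => h.
  have := nrmD x ((scal H c - adj T * T) z); have := cT z; rewrite -h.
  by move=> h1 h2; rewrite [leRHS]mulrC ler_pdivlMr //; move: h1 h2; lra.
Qed.

End Ranges.
(** * Projections and polar decomposition *)

Section Polar.
Variables (R : realType) (A : cstarAlgType R) (H : hilbertModType A).
Implicit Types (x y z : H) (S T U E F B Q : adjop H) (M N : set H) (c d e : R).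
Local Open Scope complex_scope.

(** With Z := (T^* T + e)^-1 one has T^* - T^* T Z T^* = e Z T^*, whose adjoint
    has norm O (sqrt e), since T^* T Z = 1 - e Z. *)
Lemma closure_ran_adjM T : closure (ran (adj T * T)) = closure (ran (adj T)).
Proof.
apply/seteqP; split; apply: closure_sub => _ [x _ <-].
  by apply: subset_closure; exists (T x).
apply/closure_nrmP => d0 d0p.
pose d := d0 / (16 * (nrm x + 1)).
have n0 := nrm_ge0 x.
have dp : 0 < d by rewrite divr_gt0 // mulr_gt0 // ltr_wpDl.
(* |e T Z y|^2 is at most 8 e |y|^2 = (d |y|)^2, and passing to the adjoint costs
   a factor 4. *)
pose e := d ^+ 2 / 8; have e0 : 0 < e by rewrite divr_gt0 // exprn_gt0.
have [Z [sZ TZ bZ]] := resolvent_ex T e0.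
pose G := e%:C *: (Z * adj T).
have aG : adj G = e%:C *: (T * Z) by rewrite adjZr adjM adjK sZ.
have TTZ : adj T * (T * Z) = 1 - e%:C *: Z.
  by rewrite -TZ mulrDl scalM addrK mulrA.
have bG : opbound (adj G) d.
  move=> y; apply: nrm_le_sqr; first by rewrite mulr_ge0 ?nrm_ge0 // ltW.
  have -> : adj G y = e%:C *: T (Z y) by rewrite aG.
  rewrite hipZlr hipZr !nrmZr ?(ltW e0) // adjE.
  rewrite -[adj T _]/((adj T * (T * Z)) y) TTZ.
  pose v := (1 - e%:C *: Z) y; rewrite -/v.
  have ny := nrm_ge0 y; have zy := bZ y.
  have ezy : e * nrm (Z y) <= nrm y by rewrite mulrC -ler_pdivlMr // mulrC.
  have vy : nrm v <= 2 * nrm y.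
    apply: le_trans (nrmB _ _) _; rewrite nrmZr ?(ltW e0) //.
    by rewrite (_ : 2 * nrm y = nrm y + nrm y) ?lerD2l //; ring.
  rewrite exprMn (_ : d ^+ 2 = 8 * e); last by rewrite /e; field.
  rewrite (_ : 8 * e * _ = e * (4 * (nrm y * (2 * nrm y)))); last by ring.
  rewrite ler_pM2l //; have h := hip_bound (Z y) v.
  rewrite -(ler_pM2l e0) in h; apply: le_trans h _.
  rewrite (_ : e * _ = 4 * (e * nrm (Z y) * nrm v)); last by ring.
  by rewrite ler_pM2l // ler_pM ?nrm_ge0 // mulr_ge0 ?nrm_ge0 // ltW.
have bG4 : opbound G (4 * d) by rewrite -(adjK G); apply: opbound_adj bG; apply: ltW.
have GE : adj T - adj T * (T * Z) * adj T = G.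
  by rewrite TTZ mulrBl mul1r opprB addrC subrK /G adjop_scaleAl.
exists ((adj T * T) (Z (adj T x))); first by exists (Z (adj T x)).
rewrite [X in nrm X](_ : _ = G x); last by rewrite -GE.
apply: le_lt_trans (bG4 x) _.
rewrite /d (_ : 4 * _ * _ = d0 * (nrm x / (4 * (nrm x + 1)))); last first.
  by field; rewrite gt_eqF // ltr_wpDl.
rewrite gtr_pMr // ltr_pdivrMr ?mulr_gt0 // ?ltr_wpDl // mul1r; lra.
Qed.

Lemma proj_ranP E x : is_projection E -> ran E x <-> E x = x.
Proof.
move=> [EE _]; split=> [[y _ <-]|<-]; last by exists x.
exact: (congr1 (fun T : adjop H => T y) EE).
Qed.

Lemma proj_on_unique E M : is_projection E -> ran E = M -> proj_on M = E.
Proof.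
move=> pE rE; pose P F := is_projection F /\ ran F = M.
have [pF rF] : P (proj_on M) by apply: (@xgetPex _ 0 P); exists E.
move: pF rF; set F := proj_on M => pF rF.
have absorb F1 F2 : is_projection F2 -> ran F1 `<=` ran F2 -> F2 * F1 = F1.
  by move=> p2 s; apply: adjop_ext => x; apply/(proj_ranP _ p2)/s; exists x.
have EF : E * F = F by apply: absorb => //; rewrite rE rF.
have FE : F * E = E by apply: absorb => //; rewrite rE rF.
by move: EF; rewrite -{1}(proj2 pE) -{1}(proj2 pF) -adjM FE (proj2 pE).
Qed.

Lemma proj_onP M : orth_complemented M ->
  is_projection (proj_on M) /\ ran (proj_on M) = M.
Proof.
move=> [cM oc]; have /choice[p pP] : forall x, exists y, M y /\ orth M (x - y).
  by move=> x; have [y [z [My oz ->]]] := oc x; exists y; rewrite addrC addKr.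
have orthl x y : hip (x - p x) (p y) = 0 by apply: (pP x).2; case: (pP y).
have hp x y : hip x (p y) = hip (p x) (p y).
  by apply/eqP; rewrite -subr_eq0 -hipNl -hipDl orthl.
have sp x y : hip (p x) y = hip x (p y).
  by rewrite hip_star hp -hip_star -hp.
have sub x y : M x -> M y -> M (x - y).
  by move=> Mx My; case: cM => _ _ MD MZ _; rewrite -scaleN1r; apply/MD/MZ.
have pid y : M y -> p y = y.
  move=> My; apply/esym/eqP; rewrite -subr_eq0; apply/eqP/hip_eq0.
  by apply: (pP y).2; apply: sub => //; case: (pP y).
suff PM : is_projection (Adjop sp) /\ ran (Adjop sp) = M.
  by case: (PM) => pE rE; rewrite (proj_on_unique pE rE).
split; first split.
- by apply: adjop_ext => x /=; apply: pid; case: (pP x).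
- exact: adjop_ext.
- apply/seteqP; split => [_ [x _ <-]|y My]; first by case: (pP x).
  by exists y => //=; apply: pid.
Qed.

Lemma proj_on_eq M x y : orth_complemented M -> M y -> orth M (x - y) ->
  proj_on M x = y.
Proof.
move=> /proj_onP[pE rE] My oxy; move: pE rE; set E := proj_on M => pE rE.
have Ey : E y = y by apply/(proj_ranP _ pE); rewrite rE.
rewrite -[x](subrK y) adjopD Ey; suff -> : E (x - y) = 0 by rewrite add0r.
apply: hip_inj => z; rewrite hip0r -(proj2 pE) -adjE.
by rewrite hip_star oxy -?rE; [rewrite -(hip0r (0 : H)) -hip_star hip0l | exists z].
Qed.

(** S s |-> S' s is isometric, so the closure of its graph is again the graph
    of an isometry between the closures of the ranges; composing with the
    projections makes it a partial isometry of H, whose adjoint is obtained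
    from the inverse in the same way. *)
Lemma partial_isometry_extension S S' :
  (forall x y, hip (S x) (S y) = hip (S' x) (S' y)) ->
  orth_complemented (closure (ran S)) -> orth_complemented (closure (ran S')) ->
  exists U, U * S = S' /\ adj U * U = proj_on (closure (ran S)).
Proof.
move=> iso ocS ocS'.
pose graph (S1 S2 : adjop H) (y w : H) := exists u : nat -> H,
  S1 (u n) @[n --> \oo] --> y /\ S2 (u n) @[n --> \oo] --> w.
have graph_ex S1 S2 y : (forall x z, hip (S1 x) (S1 z) = hip (S2 x) (S2 z)) ->
    closure (ran S1) y -> exists w, graph S1 S2 y w.
  move=> i12 /closure_seq[v vS vy].
  have /choice[u uP] n : exists s, S1 s = v n by have [s _ <-] := vS n; exists s.
  have vE : v = (fun n => S1 (u n)) by apply/funext => n; rewrite uP.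
  rewrite vE in vy; suff [w wP] : exists w : H, S2 (u n) @[n --> \oo] --> w.
    by exists w, u.
  apply: cauchy_nrm_cvg => e e0; move/cvg_nrmP: vy => /(_ (e / 2)).
  rewrite divr_gt0 // => /(_ isT)[N NP]; exists N => n Nn.
  rewrite -adjopB; have -> : nrm (S2 (u n - u N)) = nrm (S1 (u n - u N)).
    by apply/eqP; rewrite -(@eqrXn2 _ 2) ?nrm_ge0 // !nrm_sqr i12.
  rewrite adjopB [e]splitr; apply: le_lt_trans (nrm_dist y _ _) _.
  by rewrite ltrD ?NP // nrmC NP.
have graph_hip1 y w s : graph S S' y w -> hip y (S s) = hip w (S' s).
  move=> [u [uy uw]]; have := hip_cvgl (y := S s) uy.
  rewrite (_ : (fun n => _) = fun n => hip (S' (u n)) (S' s)); last first.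
    by apply/funext => n; rewrite iso.
  move=> h; apply: (cvg_unique (@norm_hausdorff _ _)) h _ => //.
  exact: hip_cvgl.
have graph_hip y w y' w' : graph S S' y w -> graph S S' y' w' ->
    hip y y' = hip w w'.
  move=> g [u [uy uw]]; have := hip_cvgr (y := y) uy.
  rewrite (_ : (fun n => _) = fun n => hip w (S' (u n))); last first.
    by apply/funext => n; rewrite (graph_hip1 _ _ _ g).
  move=> h; apply: (cvg_unique (@norm_hausdorff _ _)) h _ => //.
  exact: hip_cvgr.
have [pE rE] := proj_onP ocS; have [pF rF] := proj_onP ocS'.
move: pE rE pF rF; set E := proj_on (closure (ran S)); set F := proj_on _.
move=> pE rE pF rF.
have /choice[f fP] x : exists w, graph S S' (E x) w.
  by apply: graph_ex => //; rewrite -rE; exists x.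
have /choice[g gP] x : exists w, graph S S' w (F x).
  have [w [u [uw uF]]] : exists w, graph S' S (F x) w.
    by apply: graph_ex => //; rewrite -rF; exists x.
  by exists w, u.
have in_ran (K : adjop H) M y x : is_projection K -> ran K = M -> M y ->
    hip y x = hip y (K x).
  by move=> pK <- /(proj_ranP _ pK) <-; rewrite !adjE (proj2 pK)
     -[K (K x)]/((K * K) x) (proj1 pK).
have adjfg x y : hip (f x) y = hip x (g y).
  rewrite (in_ran F _ (f x) y pF rF); last first.
    by have [u [_ uf]] := fP x; apply: seq_closure uf => n; exists (u n).
  rewrite -(graph_hip _ _ _ _ (fP x) (gP y)).
  rewrite [LHS]hip_star [RHS]hip_star -(in_ran E _ (g y) x pE rE) //.
  by have [u [ug _]] := gP y; apply: seq_closure ug => n; exists (u n).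
pose U := Adjop adjfg; exists U; split.
  apply: adjop_ext => s; apply: hip_inj => z.
  have -> : hip z ((U * S) s) = hip (g z) (S s) := adjEr z (S s) U.
  rewrite (graph_hip1 _ _ _ (gP z)).
  rewrite -{1}(proj2 pF) -adjEr; congr (hip z _); apply/(proj_ranP _ pF).
  by rewrite rF; apply: subset_closure; exists s.
apply: adjop_ext => x; apply: hip_inj => z.
have -> : hip z ((adj U * U) x) = hip (f z) (f x) := adjEr z (U x) (adj U).
rewrite -(graph_hip _ _ _ _ (fP z) (fP x)) adjE (proj2 pE).
by rewrite -[E (E x)]/((E * E) x) (proj1 pE).
Qed.

Lemma op_positive_sqrt T : exists B, op_positive B /\ B * B = adj T * T.
Proof.
have [B [pB BB _]] := poscone_sqrt (poscone_adjM T).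
have [q [[sq _] qq _]] := poscone_sqrt pB.
by exists B; split => //; exists q; rewrite sq qq.
Qed.

Lemma absopP T :
  adj (absop T) = absop T /\ absop T * absop T = adj T * T.
Proof.
have [[S SE] BB] : op_positive (absop T) /\ absop T * absop T = adj T * T.
  exact: (@xgetPex _ 0 [set B | op_positive B /\ B * B = adj T * T]
           (op_positive_sqrt T)).
by split; rewrite // SE adjM adjK.
Qed.

Lemma closure_ran_absop T : closure (ran (absop T)) = closure (ran (adj T)).
Proof.
have [sB BB] := absopP T.
by rewrite -(closure_ran_adjM T) -BB -{2}sB closure_ran_adjM sB.
Qed.

(** If T = U |T|, then U U^* projects onto the closure of R(T), because R(|T|) is
    dense in R(U^* U).  Conversely | |T| x | = |T x|, so |T| x |-> T x extends to
    the required partial isometry. *)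
Lemma polarP T : has_polar_decomposition T <->
  orth_complemented (closure (ran T)) /\ orth_complemented (closure (ran (adj T))).
Proof.
have [sB BB] := absopP T; have cB := closure_ran_absop T.
split=> [[ocT' [U [pU TE UU]]]|[ocT ocT']].
  split => //; have [pE rE] := proj_onP ocT'; rewrite -UU in pE rE.
  have UUU : U * (adj U * U) = U.
    have [EE _] := pE; move: EE; set E := adj U * U => EE.
    apply/eqP; rewrite -subr_eq0 -[X in _ - X]mulr1 -mulrBr; apply/eqP/adjM_eq0.
    rewrite adjM -mulrA [adj U * _]mulrA -/E [E * (E - 1)]mulrBr.
    by rewrite (EE : E * E = E) mulr1 subrr mulr0.
  apply/oc_ranP => x; exists (U (adj U x)), (x - U (adj U x)); split.
  - have -> : U (adj U x) = U ((adj U * U) (adj U x)) by rewrite -{1}UUU.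
    have : ran (adj U * U) ((adj U * U) (adj U x)) by exists (adj U x).
    rewrite rE -cB; apply: (closure_map (S := U)) => _ [y _ <-]; exists y => //.
    by rewrite [in LHS]TE.
  - have -> : adj T (x - U (adj U x)) = absop T (adj U (x - U (adj U x))).
      by rewrite [in LHS]TE adjM sB.
    rewrite [adj U (_ - _)]adjopB.
    have -> : adj U (U (adj U x)) = adj U x.
      by rewrite -[in RHS]UUU !adjM adjK.
    by rewrite subrr adjop0.
  - by rewrite addrC subrK.
split => //.
have [|||U [UB UU]] := @partial_isometry_extension (absop T) T.
- move=> x y; rewrite adjE [RHS]adjE sB -[X in hip x X]/((absop T * absop T) y).
  by rewrite BB.
- by rewrite cB.
- by [].
exists U; rewrite cB in UU; split => //.
by rewrite /partial_isometry UU; case: (proj_onP ocT').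
Qed.

Lemma idem_ran_closed Q : is_idempotent Q -> closure (ran Q) = ran Q.
Proof.
move=> QQ; apply/seteqP; split; last exact: subset_closure.
move=> x /(@closure_ran_eq0 _ _ _ (1 - Q)) h; exists x => //.
apply/eqP; rewrite eq_sym -subr_eq0; apply/eqP/h.
by rewrite mulrBl mul1r (QQ : Q * Q = Q) subrr.
Qed.

(** (Q + Q^* - 1)^2 = 1 + D^* D with D := Q - Q^*, so Q + Q^* - 1 is onto; and
    (Q + Q^* - 1) y is the sum of Q y, in the range of Q, and of Q^* y - y, in
    the kernel of Q^*. *)
Lemma idem_ran_oc Q : is_idempotent Q -> orth_complemented (ran Q).
Proof.
move=> QQ; rewrite -(idem_ran_closed QQ); apply/oc_ranP => x.
have aQQ : adj Q * adj Q = adj Q by rewrite -adjM QQ.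
pose D := Q - adj Q; pose G := Q + adj Q - 1.
have GG : adj D * D + scal H 1 = G * G.
  have sum_G : (Q + adj Q) * G = Q * adj Q + adj Q * Q.
    rewrite /G mulrBr mulr1 mulrDl !mulrDr aQQ (QQ : Q * Q = Q).
    by rewrite [adj Q * Q + _]addrC addrACA [LHS]addrC addKr.
  rewrite {1}/G mulrBl mul1r sum_G adjB adjK /scal scale1r /D /G.
  rewrite mulrBl !mulrBr aQQ (QQ : Q * Q = Q) opprB addrACA -opprD.
  by rewrite opprB -[LHS]addrA [- _ + 1]addrC [adj Q * Q + _]addrC [adj Q + Q]addrC.
have [Z [_ Z1 _]] := resolvent_ex D (@ltr01 R).
pose y := G (Z x).
have Gy : G y = x.
  by rewrite -[RHS]/((1 : adjop H) x) -Z1 GG.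
exists (Q y), (adj Q y - y); split.
- by apply: subset_closure; exists y.
- by rewrite adjopB -[adj Q (adj Q y)]/((adj Q * adj Q) y) aQQ subrr.
- by rewrite -[LHS]Gy /= addrA.
Qed.

End Polar.
(** * Orthogonal splittings and quasi-projection pairs *)

Section ReflectedPairs.
Variables (R : realType) (A : cstarAlgType R) (H : hilbertModType A).
Implicit Types (x y z : H) (S T P Q J : adjop H) (K M N : set H).

Lemma closed_submoduleI M N :
  closed_submodule M -> closed_submodule N -> closed_submodule (M `&` N).
Proof.
move=> [cM M0 MD MZ Ma] [cN N0 ND NZ Na]; split.
- exact: closedI.
- by [].
- by move=> x y [? ?] [? ?]; split; [apply: MD | apply: ND].
- by move=> k x [? ?]; split; [apply: MZ | apply: NZ].
- by move=> x a [? ?]; split; [apply: Ma | apply: Na].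
Qed.

Lemma orth_split K M N : orth_complemented K ->
  closed_submodule M -> closed_submodule N -> M `<=` K -> N `<=` K ->
  (forall m n, M m -> N n -> hip m n = 0) ->
  (forall x, K x -> exists m n, [/\ M m, N n & x = m + n]) ->
  [/\ orth_complemented M, orth_complemented N &
      proj_on K = proj_on M + proj_on N].
Proof.
move=> ocK cM cN MK NK MN split_K.
have NM m n : M m -> N n -> hip n m = 0.
  by move=> Mm Nn; rewrite hip_star MN // -(hip0r (0 : H)) -hip_star hip0l.
have dec x : exists m n k, [/\ M m, N n, orth K k & x = m + n + k].
  have [y [k [Ky ok ->]]] := ocK.2 x; have [m [n [Mm Nn ->]]] := split_K y Ky.
  by exists m, n, k.
have oM m n k : N n -> orth K k -> orth M (n + k).
  by move=> Nn ok y My; rewrite hipDl NM // ok ?add0r //; apply: MK.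
have oN m n k : M m -> orth K k -> orth N (m + k).
  by move=> Mm ok y Ny; rewrite hipDl MN // ok ?add0r //; apply: NK.
have ocM : orth_complemented M.
  split=> // x; have [m [n [k [Mm Nn ok ->]]]] := dec x.
  by exists m, (n + k); split; rewrite ?addrA //; apply: oM.
have ocN : orth_complemented N.
  split=> // x; have [m [n [k [Mm Nn ok ->]]]] := dec x.
  by exists n, (m + k); split; rewrite ?[m + n]addrC ?addrA //; apply: oN.
split=> //; apply: adjop_ext => x; have [m [n [k [Mm Nn ok xE]]]] := dec x.
rewrite [RHS]/= (proj_on_eq (y := m) ocM) //; last first.
  by rewrite xE -[m + n + k]addrA addrAC subrr add0r; apply: oM.
rewrite (proj_on_eq (y := n) ocN) //; last first.
  by rewrite xE [m + n]addrC -[n + m + k]addrA addrAC subrr add0r; apply: oN.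
apply: proj_on_eq => //; last by rewrite xE addrAC subrr add0r.
by case: ocK => -[_ _ KD _ _] _; apply: KD; [apply: MK | apply: NK].
Qed.

Lemma idem_ranP Q x : is_idempotent Q -> ran Q x <-> Q x = x.
Proof.
move=> QQ; split=> [[y _ <-]|<-]; last by exists x.
exact: (congr1 (fun T : adjop H => T y) QQ).
Qed.

Lemma idem_compl Q : is_idempotent Q -> is_idempotent (1 - Q).
Proof.
by move=> QQ; rewrite /is_idempotent mulrBr mulr1 mulrBl mul1r (QQ : Q * Q = Q)
  subrr subr0.
Qed.

Lemma ran_compl Q : is_idempotent Q -> ran (1 - Q) = ker Q.
Proof.
move=> QQ; apply/seteqP; split=> x /=.
  move=> /(idem_ranP _ (idem_compl QQ)) /= /eqP.
  by rewrite eq_sym addrC -subr_eq subrr eq_sym oppr_eq0 => /eqP.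
by move=> Qx; exists x => //=; rewrite Qx subr0.
Qed.

Lemma proj_compl P : is_projection P -> is_projection (1 - P).
Proof.
by move=> [PP sP]; split; [apply: idem_compl | rewrite adjB adj1 sP].
Qed.

Lemma closure_idem_ran Q T : is_idempotent Q -> closure (ran (Q * T)) `<=` ran Q.
Proof.
move=> QQ; rewrite -[ran Q](idem_ran_closed QQ); apply: closureS.
by move=> _ [x _ <-]; exists (T x).
Qed.

Definition refl P : adjop H := 2 * P - 1.

(** The form of a quasi-projection pair that is visibly invariant under
    (P, Q) |-> (1 - P, 1 - Q), as this only changes the sign of refl P. *)
Definition reflected_pair P Q :=
  [/\ is_projection P, is_idempotent Q & adj Q = refl P * Q * refl P].

Lemma reflE P : refl P = P - (1 - P).
Proof. by rewrite /refl mulr_natl mulr2n opprB addrA. Qed.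

Lemma refl_compl P : refl (1 - P) = - refl P.
Proof. by rewrite !reflE subKr opprB. Qed.

Lemma refl_mulP P : is_projection P -> refl P * P = P.
Proof.
by move=> [PP _]; rewrite reflE !mulrBl mul1r (PP : P * P = P) subrr subr0.
Qed.

Lemma refl_refl P : is_projection P -> refl P * refl P = 1.
Proof.
move=> pP; rewrite {2}/refl mulrBr mulr1 mulr_natl mulrnAr refl_mulP //.
by rewrite /refl mulr_natl subKr.
Qed.

Lemma adj_refl P : is_projection P -> adj (refl P) = refl P.
Proof. by move=> [_ sP]; rewrite !reflE !adjB adj1 sP. Qed.

(** The identity for the remaining block (1 - P) Q^* P is the adjoint of the one
    for P Q^* (1 - P). *)
Lemma quasi_projection_pair_reflected P Q :
  quasi_projection_pair P Q -> reflected_pair P Q.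
Proof.
move=> [pP QQ e11 e12 e22]; have [_ sN] := proj_compl pP; have [PP sP] := pP.
split=> //; rewrite reflE; move: e12 e22 sN; set N := 1 - P => e12 e22 sN.
have e21 : N * adj Q * P = - (N * Q * P).
  have := congr1 (@adj _ _ _) e12; rewrite !(adjN, adjM) adjK sP sN !mulrA => e.
  by rewrite e opprK.
have PN : P + N = 1 by rewrite addrC subrK.
have dec (T : adjop H) : T = P * T * P + P * T * N + (N * T * P + N * T * N).
  by rewrite -!mulrDr -mulrDl PN !mulr1 -mulrDl PN mul1r.
clearbody N.
rewrite [LHS]dec e11 e12 e21 e22 mulrBl mulrBr !mulrBl opprB.
by rewrite [- _ + _]addrC addrACA [RHS]addrACA [X in _ = _ + X]addrC.
Qed.

Lemma reflected_pair_compl P Q :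
  reflected_pair P Q -> reflected_pair (1 - P) (1 - Q).
Proof.
move=> [pP QQ aQ]; split; [exact: proj_compl | exact: idem_compl | ].
rewrite adjB adj1 aQ refl_compl mulrN !mulNr opprK.
rewrite [refl P * (1 - Q)]mulrBr mulr1 [RHS]mulrBl.
by rewrite refl_refl.
Qed.

(** For h in H1 := R(P) /\ R(Q) also Q^* h = h, so h is orthogonal to the ranges
    of P (1 - Q) and of Q (1 - P); conversely H1 exhausts the orthogonal
    complement of the former in R(P) and of the latter in R(Q).  The identities
    Q P (1 - Q) = - Q (1 - P) (1 - Q) and P Q (1 - P) = - P (1 - Q) (1 - P) let
    Q and P carry one decomposition into the other, so that both hold
    together. *)
Lemma reflected_pair_half P Q : reflected_pair P Q ->
  let M := closure (ran (P * (1 - Q))) in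
  let N := closure (ran (Q * (1 - P))) in
  let H1 := ran P `&` ran Q in
  (orth_complemented M <-> orth_complemented N) /\
  (orth_complemented M ->
   [/\ orth_complemented H1, P = proj_on M + proj_on H1 &
       proj_on (ran Q) = proj_on N + proj_on H1]).
Proof.
move=> [pP QQ aQ] M N H1; have [PP sP] := pP.
have rP x := idem_ranP x PP; have rQ x := idem_ranP x QQ.
have ev (S T : adjop H) x : S = T -> S x = T x by move->.
have Jx x : P x = x -> refl P x = x.
  by move=> Px; rewrite -{1}Px; apply: etrans (ev _ _ x (refl_mulP pP)) Px.
have JJ x : refl P (refl P x) = x := ev _ _ x (refl_refl pP).
have aQx x : adj Q x = refl P (Q (refl P x)) := ev _ _ x aQ.
have fixQ x : P x = x -> Q x = x <-> adj Q x = x.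
  move=> Px; rewrite aQx (Jx x Px); split=> [->|h]; first exact: Jx.
  by rewrite -[LHS]JJ h Jx.
have H1M m h : M m -> H1 h -> hip m h = 0.
  move=> Mm [/rP Ph /rQ Qh]; rewrite hip_star.
  suff -> : hip h m = 0 by rewrite -(hip0r (0 : H)) -hip_star hip0l.
  apply: orth_closure Mm => _ [x _ <-]; rewrite adjEr adjM adjB adj1 sP /= Ph.
  by rewrite (_ : adjop_adj Q h = h) ?subrr ?hip0l //; apply/(fixQ _ Ph).
have H1N n h : N n -> H1 h -> hip n h = 0.
  move=> Nn [/rP Ph /rQ Qh]; rewrite hip_star.
  suff -> : hip h n = 0 by rewrite -(hip0r (0 : H)) -hip_star hip0l.
  apply: orth_closure Nn => _ [x _ <-]; rewrite adjEr adjM adjB adj1 sP /=.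
  rewrite (_ : adjop_adj Q h = h) ?Ph ?subrr ?hip0l //.
  by apply/(fixQ _ Ph).
pose splitP := forall x, ran P x -> exists m h, [/\ M m, H1 h & x = m + h].
pose splitQ := forall x, ran Q x -> exists n h, [/\ N n, H1 h & x = n + h].
have MP : M `<=` ran P by apply: closure_idem_ran.
have NQ : N `<=` ran Q by apply: closure_idem_ran.
have cP : closed_submodule (ran P).
  by rewrite -(idem_ran_closed PP); apply: closure_ranP.
have cQ : closed_submodule (ran Q).
  by rewrite -(idem_ran_closed QQ); apply: closure_ranP.
have cM : closed_submodule M := closure_ranP _.
have cN : closed_submodule N := closure_ranP _.
have cH1 := closed_submoduleI cP cQ.
have M_split : orth_complemented M -> splitP.
  move=> /oc_ranP oc x /rP Px; have [m [z [Mm oz xE]]] := oc x.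
  exists m, z; split => //.
  have Pz : P z = z.
    apply: (addrI m); rewrite -xE -[in RHS]Px xE adjopD; congr (_ + _).
    by apply/esym/rP/MP.
  split; [exact/rP | apply/rQ/(fixQ _ Pz).2].
  move: oz; rewrite adjM adjB adj1 sP /= Pz => /eqP.
  by rewrite subr_eq0 eq_sym => /eqP.
have N_split : orth_complemented N -> splitQ.
  move=> /oc_ranP oc x /rQ Qx; have [n [z [Nn oz xE]]] := oc x.
  exists n, z; split => //.
  have Qz : Q z = z.
    apply: (addrI n); rewrite -xE -[in RHS]Qx xE adjopD; congr (_ + _).
    by apply/esym/rQ/NQ.
  (* w := Q^* z lies in H1, and z - w is fixed by Q and killed by Q^*, hence is
     orthogonal to itself. *)
  pose w := adj Q z.
  have Pw : P w = w.
    move: oz; rewrite adjM adjB adj1 sP /= => /eqP.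
    by rewrite subr_eq0 eq_sym => /eqP.
  have aQw : adj Q w = w.
    by have := congr1 (fun T : adjop H => adj T z) QQ; rewrite adjM.
  have Qw : Q w = w by apply/(fixQ _ Pw).2.
  suff -> : z = w by split; [apply/rP | apply/rQ].
  apply/eqP; rewrite -subr_eq0; apply/eqP/hip_eq0.
  rewrite -{1}(_ : Q (z - w) = z - w); last by rewrite adjopB Qz Qw.
  by rewrite adjE adjopB aQw subrr hip0r.
have M_orth : splitP -> [/\ orth_complemented M, orth_complemented H1 &
    proj_on (ran P) = proj_on M + proj_on H1].
  move=> sp; apply: orth_split => //; [exact: idem_ran_oc | exact: subIsetl].
have N_orth : splitQ -> [/\ orth_complemented N, orth_complemented H1 &
    proj_on (ran Q) = proj_on N + proj_on H1].
  move=> sp; apply: orth_split => //; [exact: idem_ran_oc | exact: subIsetr].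
have [_ _ ND NZ _] := cN; have [_ _ MD MZ _] := cM.
have PQ_split : splitP -> splitQ.
  move=> sp x /rQ Qx; have [|m [h [Mm hH xE]]] := sp (P x); first by exists x.
  exists (Q m + Q ((1 - P) x)), h; split => //.
  - apply: ND; last by apply: subset_closure; exists x.
    apply: (closure_map (S := Q)) Mm => _ [y _ <-]; exists (- (1 - Q) y) => //.
    rewrite adjopN /= -[Q (P _)]/(Q (P ((1 - Q) y))) !adjopB.
    by rewrite -[Q (Q y)]/((Q * Q) y) (QQ : Q * Q = Q); rewrite subrr sub0r opprK.
  - have Qh : Q h = h by apply/rQ; case: hH.
    rewrite -[LHS]Qx -{1}(subrK (P x) x) adjopD.
    by rewrite [X in _ + Q X]xE adjopD Qh addrCA addrA.
have QP_split : splitQ -> splitP.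
  move=> sp x /rP Px; have [|n [h [Nn hH xE]]] := sp (Q x); first by exists x.
  exists (P n + P ((1 - Q) x)), h; split => //.
  - apply: MD; last by apply: subset_closure; exists x.
    apply: (closure_map (S := P)) Nn => _ [y _ <-]; exists (- (1 - P) y) => //.
    rewrite adjopN /= !adjopB.
    by rewrite -[P (P y)]/((P * P) y) (PP : P * P = P); rewrite subrr sub0r opprK.
  - have Ph : P h = h by apply/rP; case: hH.
    rewrite -[LHS]Px -{1}(subrK (Q x) x) adjopD.
    by rewrite [X in _ + P X]xE adjopD Ph addrCA addrA.
split=> [|/M_split sp].
  by split=> [/M_split/PQ_split/N_orth[]|/N_split/QP_split/M_orth[]].
have [_ oc1 <-] := M_orth sp; have [_ _ <-] := N_orth (PQ_split sp).
by split => //; rewrite (proj_on_unique pP erefl).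
Qed.

Lemma ran_mul_unit S T : T * T = 1 -> ran (S * T) = ran S.
Proof.
move=> TT; apply/seteqP; split=> [_ [x _ <-]|_ [x _ <-]]; first by exists (T x).
exists (T x) => //=; congr (S _).
exact: (congr1 (fun U : adjop H => U x) TT).
Qed.

Lemma ran_opp T : ran (- T) = ran T.
Proof.
apply/seteqP; split=> [_ [x _ <-]|_ [x _ <-]]; exists (- x) => //=;
  by rewrite adjopN ?opprK.
Qed.

Lemma orth_complemented_unit J T : adj J = J -> J * J = 1 ->
  orth_complemented (closure (ran T)) ->
  orth_complemented (closure (ran (J * T))).
Proof.
move=> sJ JJ /oc_ranP oc; have JJx x : J (J x) = x.
  exact: (congr1 (fun U : adjop H => U x) JJ).
apply/oc_ranP => x; have [y [z [cy Tz xE]]] := oc (J x).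
exists (J y), (J z); split.
- by apply: (closure_map (S := J)) cy => _ [s _ <-]; exists s.
- by rewrite adjM sJ /= JJx.
- by rewrite -adjopD -xE JJx.
Qed.

End ReflectedPairs.

Theorem theorem3p6 (R : realType) (A : cstarAlgType R) (H : hilbertModType A)
    (P Q : adjop H) :
  quasi_projection_pair P Q ->
  let T1 := P * (1 - Q) in
  let T2 := (1 - P) * Q in
  let T1t := T1 * (2 * P - 1) in
  let T2t := - (T2 * (2 * P - 1)) in
  let H1 := ran P `&` ran Q in
  let H4 := ker P `&` ker Q in
  let oc_ran (T : adjop H) := orth_complemented (closure (ran T)) in
  [<-> semi_harmonious P Q;
       oc_ran T1 /\ oc_ran T2;
       oc_ran (adj T1) /\ oc_ran (adj T2);
       oc_ran T1t /\ oc_ran T2t;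
       oc_ran (adj T1t) /\ oc_ran (adj T2t);
       oc_ran T1 /\ oc_ran (adj T1);
       has_polar_decomposition T1;
       oc_ran (adj T1) /\ oc_ran (adj T2t);
       oc_ran T2 /\ oc_ran (adj T2);
       has_polar_decomposition T2;
       oc_ran (adj T2) /\ oc_ran (adj T1t)] /\
  (semi_harmonious P Q ->
   [/\ orth_complemented H1,
       orth_complemented H4 &
       [/\ P = proj_on (closure (ran T1)) + proj_on H1,
           proj_on (ran Q) = proj_on (closure (ran (adj T2t))) + proj_on H1,
           1 - P = proj_on (closure (ran T2)) + proj_on H4 &
           proj_on (ker Q) = proj_on (closure (ran (adj T1t))) + proj_on H4]]).
Proof.
move=> /quasi_projection_pair_reflected rp T1 T2 T1t T2t H1 H4 oc_ran.
have rpc := reflected_pair_compl rp; have [pP QQ aQ] := rp; have [PP sP] := pP.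
pose J := refl P; have JJ : J * J = 1 := refl_refl pP.
have sJ : adj J = J := adj_refl pP.
have aT1 : adj T1 = J * ((1 - Q) * P).
  have [_ _ aQc] := rpc.
  rewrite /T1 adjM sP aQc refl_compl mulrN !mulNr opprK -mulrA.
  by rewrite refl_mulP // -mulrA.
have aT1t : adj T1t = (1 - Q) * P.
  by rewrite /T1t adjM -/(refl P) -/J sJ aT1 mulrA JJ mul1r.
have aT2 : adj T2 = J * - (Q * (1 - P)).
  rewrite /T2 adjM (proj2 (proj_compl pP)) aQ -!mulrA; congr (_ * _).
  rewrite -[refl P]opprK -refl_compl mulNr refl_mulP ?mulrN //.
  exact: proj_compl.
have aT2t : adj T2t = Q * (1 - P).
  by rewrite /T2t adjN adjM -/(refl P) -/J sJ aT2 mulrA JJ mul1r opprK.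
have ocT1t : oc_ran T1t = oc_ran T1 by rewrite /oc_ran (ran_mul_unit _ JJ).
have ocT2t : oc_ran T2t = oc_ran T2.
  by rewrite /oc_ran ran_opp (ran_mul_unit _ JJ).
have ocJ T : oc_ran (J * T) <-> oc_ran T.
  split; last exact: orth_complemented_unit.
  by move=> /(orth_complemented_unit sJ JJ); rewrite mulrA JJ mul1r.
have ocaT1 : oc_ran (adj T1) <-> oc_ran (adj T1t).
  by rewrite aT1 aT1t; apply: ocJ.
have ocaT2 : oc_ran (adj T2) <-> oc_ran (adj T2t).
  by rewrite aT2 aT2t -[oc_ran (Q * _)]/(oc_ran _) (ocJ _) /oc_ran ran_opp.
have [oc1 H1P] : (oc_ran T1 <-> oc_ran (adj T2t)) /\ (oc_ran T1 ->
    [/\ orth_complemented H1, P = proj_on (closure (ran T1)) + proj_on H1 &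
        proj_on (ran Q) = proj_on (closure (ran (adj T2t))) + proj_on H1]).
  by rewrite aT2t; apply: reflected_pair_half.
have [oc2 H4P] : (oc_ran T2 <-> oc_ran (adj T1t)) /\ (oc_ran T2 ->
    [/\ orth_complemented H4, 1 - P = proj_on (closure (ran T2)) + proj_on H4 &
        proj_on (ker Q) = proj_on (closure (ran (adj T1t))) + proj_on H4]).
  have := reflected_pair_half rpc; rewrite /= !subKr !ran_compl // -aT1t.
  by [].
have pol1 := polarP T1; have pol2 := polarP T2.
split; last first.
  move=> [/pol1[h1 _] /pol2[h2 _]].
  by have [? ? ?] := H1P h1; have [? ? ?] := H4P h2.
rewrite ocT1t ocT2t /semi_harmonious -/T1 -/T2.
move: pol1 pol2; rewrite -!/(oc_ran _).
by move=> pol1 pol2; tfae; tauto.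
Qed.
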